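(* There exist branched holomorphic projective structures on compact complex surfaces which are normal but not flat. That is, there exist a compact connected complex surface $X$ and a branched holomorphic Cartan geometry $(E_H,\theta)$ on $X$ of type $G/H$, with $G=\mathrm{PGL}(3,\mathbb C)$ and $H=Q\subset\mathrm{PGL}(3,\mathbb C)$ the stabilizer of a point of $\mathbb CP^2$, that is normal but not flat.
   Context: Let $G$ be a connected complex Lie group and $H\subset G$ a connected complex Lie subgroup, with Lie algebras $\mathfrak g$ and $\mathfrak h$; let $X$ be a connected complex manifold. For a holomorphic principal $H$-bundle $E_H$ on $X$, put $E_G=E_H\times^H G$, $\mathrm{ad}(E_H)=E_H\times^H\mathfrak h$, $\mathrm{ad}(E_G)=E_G\times^G\mathfrak g$ (adjoint bundles), with the natural inclusion $\iota_1:\mathrm{ad}(E_H)\to\mathrm{ad}(E_G)$. Let $\mathrm{At}(E_H)=(TE_H)/H$ and $\mathrm{At}(E_G)=(TE_G)/G$ be the Atiyah bundles, with Atiyah exact sequence $0\to\mathrm{ad}(E_H)\xrightarrow{\iota_2}\mathrm{At}(E_H)\to TX\to 0$ (and likewise for $E_G$). A holomorphic connection on $E_G$ is a holomorphic homomorphism $\mathrm{At}(E_G)\to\mathrm{ad}(E_G)$ restricting to the identity on $\mathrm{ad}(E_G)$. A branched holomorphic Cartan geometry on $X$ of type $G/H$ is a pair $(E_H,\theta)$, where $E_H$ is a holomorphic principal $H$-bundle on $X$ and $\theta:\mathrm{At}(E_H)\to\mathrm{ad}(E_G)$ is a holomorphic homomorphism of vector bundles which is an isomorphism over a nonempty open subset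 of $X$ and satisfies $\theta\circ\iota_2=\iota_1$. Since $\mathrm{At}(E_G)=(\mathrm{At}(E_H)\oplus\mathrm{ad}(E_G))/\mathrm{ad}(E_H)$ (with $\mathrm{ad}(E_H)$ embedded by $v\mapsto(\iota_2(v),-\iota_1(v))$), the map $(v,w)\mapsto\theta(v)+w$ induces a holomorphic connection $\theta'$ on $E_G$, with curvature $\mathrm{Curv}(\theta')\in H^0(X,\mathrm{ad}(E_G)\otimes\Omega^2_X)$. The branched Cartan geometry is called normal if $\mathrm{Curv}(\theta')$ lies in $H^0(X,\mathrm{ad}(E_H)\otimes\Omega^2_X)$, and flat if $\mathrm{Curv}(\theta')=0$. *)

(* Defs.v *)
From HB Require Import structures.
From mathcomp Require Import all_boot all_order all_algebra.
From mathcomp Require Import all_classical all_reals all_analysis.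
From mathcomp Require Import complex.

Set Implicit Arguments.
Unset Strict Implicit.
Unset Printing Implicit Defensive.

Import Order.TTheory GRing.Theory Num.Theory.
Import numFieldNormedType.Exports.

Local Open Scope classical_set_scope.
Local Open Scope ring_scope.

(** The ground field [C] is an arbitrary [numFieldType] in this file; it is
    meant to be [R[i]] for a [realType] [R], and "holomorphic" is C-differentiability (in the sense of
    Frechet) at every point of an open set.

    Manifolds and bundles are introduced as bare data (types with charts), on
    which all constructions (tangent bundle, associated bundles, ...) are
    total; the axioms are separate predicates [is_manifold], [is_pbundle]. *)

Section Quotient.
Variables (T A : Type) (act : T -> A -> T).

Definition quot := {o : set T | exists t, o = range (act t)}.

Definition cl (t : T) : quot := exist _ (range (act t)) (ex_intro _ t erefl).

Definition rep (o : quot) : T := sval (cid (svalP o)).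

Lemma repE (o : quot) : sval o = range (act (rep o)).
Proof. by rewrite /rep; case: cid. Qed.

Lemma repK (o : quot) : cl (rep o) = o.
Proof.
rewrite /cl; move: (repE o); case: o => o po /= E.
exact: eq_exist.
Qed.

Lemma cl_eq t u : range (act t) = range (act u) -> cl t = cl u.
Proof. by move=> E; exact: eq_exist. Qed.

Lemma cl_inj t u : cl t = cl u -> range (act t) = range (act u).
Proof. by move=> /(congr1 (@sval _ _)). Qed.

End Quotient.

Section Manifolds.
Variable C : numFieldType.

(** [cinv] is the inverse of [cmap] on [cmap @` cdom]; the values of [cmap]
    outside [cdom], and of [cinv] outside the image, are irrelevant. *)
Record chart (M : Type) n := Chart {
  cdom : set M;
  cmap : M -> 'rV[C]_n;
  cinv : 'rV[C]_n -> M }.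

(** The atlas is [range chart_at]: it is indexed by the points, the chart
    [chart_at x] being defined around [x].  Every holomorphic atlas contains
    such a subatlas. *)
Record manifold n := Manifold {
  mpt :> Type;
  chart_at : mpt -> chart mpt n }.

(** The topology for which the charts are homeomorphisms onto open sets. *)
Section Topology.
Variables (n : nat) (M : manifold n).

Definition mopen : set_system (mpt M) :=
  [set A | forall x p, A p -> cdom (chart_at x) p ->
     \forall y \near cmap (chart_at x) p, A (cinv (chart_at x) y)].

Lemma mopenT : mopen setT.
Proof. by move=> x p _ _; exact: filterE. Qed.

Lemma mopenI : setI_closed mopen.
Proof.
move=> A B oA oB x p [Ap Bp] dp.
by apply: filterS2 (oA x p Ap dp) (oB x p Bp dp) => y; split.
Qed.

Lemma mopen_bigU (I : Type) (f : I -> set (mpt M)) :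
  (forall i, mopen (f i)) -> mopen (\bigcup_i f i).
Proof.
move=> of_ x p [i _ fip] dp.
by apply: filterS (of_ i x p fip dp) => y; exists i.
Qed.

HB.instance Definition _ := gen_eqMixin (mpt M).
HB.instance Definition _ := gen_choiceMixin (mpt M).
HB.instance Definition _ :=
  isOpenTopological.Build (mpt M) mopenT mopenI mopen_bigU.
End Topology.

Definition is_manifold n (M : manifold n) : Prop :=
  [/\ forall x : M, cdom (chart_at x) x,
      forall (x p : M), cdom (chart_at x) p ->
        cinv (chart_at x) (cmap (chart_at x) p) = p,
      forall x y : M,
        open (cmap (chart_at x) @` (cdom (chart_at x) `&` cdom (chart_at y))) /\
        forall p, cdom (chart_at x) p -> cdom (chart_at y) p ->
          differentiable (cmap (chart_at y) \o cinv (chart_at x))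
            (cmap (chart_at x) p),
      hausdorff_space (mpt M) &
      @second_countable (mpt M)].

(** [f] read in the charts [chart_at x] and [chart_at (f x)]. *)
Definition wr m n (M : manifold m) (N : manifold n) (f : M -> N) (x : M) :
    'rV[C]_m -> 'rV[C]_n :=
  cmap (chart_at (f x)) \o f \o cinv (chart_at x).

Definition holo_at m n (M : manifold m) (N : manifold n) (f : M -> N) (x : M)
    : Prop :=
  {for x, continuous (f : mpt M -> mpt N)} /\
  differentiable (wr f x) (cmap (chart_at x) x).

Definition holo_on m n (M : manifold m) (N : manifold n) (A : set M)
    (f : M -> N) : Prop :=
  open (A : set (mpt M)) /\ forall x, A x -> holo_at f x.

Definition holo m n (M : manifold m) (N : manifold n) (f : M -> N) : Prop :=
  holo_on setT f.

(** The tangent space at [x] is 'rV_n, a vector being given by its coordinates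
    in [chart_at x]; [mderiv f x] is the differential T_x M -> T_(f x) N. *)
Definition mderiv m n (M : manifold m) (N : manifold n) (f : M -> N) (x : M) :
    'rV[C]_m -> 'rV[C]_n :=
  'd (wr f x) (cmap (chart_at x) x).

(** Coordinates in another chart [c] of a vector of T_p M, and back. *)
Definition to_chart n (M : manifold n) (c : chart M n) (p : M)
    (v : 'rV[C]_n) : 'rV[C]_n :=
  'd (cmap c \o cinv (chart_at p)) (cmap (chart_at p) p) v.

Definition of_chart n (M : manifold n) (c : chart M n) (y : 'rV[C]_n)
    (v : 'rV[C]_n) : 'rV[C]_n :=
  'd (cmap (chart_at (cinv c y)) \o cinv c) y v.

Definition vecm n : manifold n :=
  @Manifold n 'rV[C]_n (fun=> Chart setT id id).

Definition prodm m n (M : manifold m) (N : manifold n) : manifold (m + n) :=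
  @Manifold (m + n) (M * N)%type (fun q =>
    let c := chart_at q.1 in let d := chart_at q.2 in
    Chart (cdom c `*` cdom d)
      (fun r => row_mx (cmap c r.1) (cmap d r.2))
      (fun y => (cinv c (lsubmx y), cinv d (rsubmx y)))).

Definition tangentm n (M : manifold n) : manifold (n + n) :=
  @Manifold (n + n) (M * 'rV[C]_n)%type (fun q =>
    let c := chart_at q.1 in
    Chart [set r | cdom c r.1]
      (fun r => row_mx (cmap c r.1) (to_chart c r.1 r.2))
      (fun y => (cinv c (lsubmx y), of_chart c (lsubmx y) (rsubmx y)))).

(** Holomorphic maps between the quotients of two manifolds by actions for
    which the quotient maps admit local holomorphic sections (as is the case
    for free proper actions). *)
Definition holo_quot m n (M : manifold m) (N : manifold n) (A B : Type)
    (actM : M -> A -> M) (actN : N -> B -> N) (f : quot actM -> quot actN)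
    : Prop :=
  forall x : M, exists (U : set M) (F : M -> N),
    [/\ U x, holo_on U F & forall y, U y -> f (cl actM y) = cl actN (F y)].

Record liegroup n := LieGroup {
  lg :> groupType;
  lg_chart : lg -> chart lg n }.

Definition lgm n (G : liegroup n) : manifold n := Manifold (@lg_chart n G).
Local Coercion lgm : liegroup >-> manifold.

Section LieAlgebra.
Variables (n : nat) (G : liegroup n).

(** The Lie algebra is T_1 G = 'rV_n. *)
Definition Ad (g : G) : 'rV[C]_n -> 'rV[C]_n :=
  mderiv (M := G) (N := G) (fun x => g * x * g^-1)%g 1%g.

(** Left-invariant vector field with value [u] at 1, in the chart at 1. *)
Definition left_field (u : 'rV[C]_n) (y : 'rV[C]_n) : 'rV[C]_n :=
  let c := chart_at (1%g : lgm G) in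
  'd (fun t => cmap c (cinv c y * cinv c t)%g) (cmap c 1%g) u.

(** Value at 1 of the Lie bracket of left-invariant vector fields. *)
Definition lie_bracket (u v : 'rV[C]_n) : 'rV[C]_n :=
  let o := cmap (chart_at (1%g : lgm G)) 1%g in
  'd (left_field v) o u - 'd (left_field u) o v.
End LieAlgebra.

(** Around [x], a trivialization over the open set [triv_dom x] is given by a
    section [triv_sec x] and by the fibre coordinate [triv_fib x], i.e.
    e = triv_sec x (p e) . triv_fib x e. *)
Record pbundle n m (X : manifold n) (H : liegroup m) := PBundle {
  tot :> manifold (n + m);
  pproj : tot -> X;
  ract : tot -> H -> tot;
  triv_dom : X -> set X;
  triv_sec : X -> X -> tot;
  triv_fib : X -> tot -> H }.

Definition is_pbundle n m (X : manifold n) (H : liegroup m) (E : pbundle X H)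
    : Prop :=
  [/\ is_manifold E /\ holo (@pproj _ _ _ _ E),
      holo (M := prodm E H) (N := E) (fun q => ract q.1 q.2),
      (forall e : E, ract e 1%g = e) /\
      (forall (e : E) h k, ract e (h * k)%g = ract (ract e h) k),
      forall (e : E) h, pproj (ract e h) = pproj e &
      forall x : X,
        [/\ triv_dom E x x /\ holo_on (triv_dom E x) (triv_sec E x),
            holo_on (N := H) (@pproj _ _ _ _ E @^-1` triv_dom E x) (triv_fib x),
            forall y, triv_dom E x y -> pproj (triv_sec E x y) = y,
            forall e : E, triv_dom E x (pproj e) ->
              ract (triv_sec E x (pproj e)) (triv_fib x e) = e &
            forall y h, triv_dom E x y ->
              triv_fib x (ract (triv_sec E x y) h) = h]].

Section AdAt.
Variables (n m : nat) (X : manifold n) (H : liegroup m) (E : pbundle X H).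

Definition ad_act (q : prodm E (vecm m)) (h : H) : prodm E (vecm m) :=
  (ract q.1 h, Ad h^-1%g q.2).

Definition ad := quot ad_act.

Definition ad_cl (e : E) (u : 'rV[C]_m) : ad := cl ad_act (e, u).

Definition ad_proj (b : ad) : X := pproj (rep b).1.

(** The coordinate u of b = [e, u] in the frame e. *)
Definition ad_coord (e : E) (b : ad) : 'rV[C]_m :=
  xget 0 [set u | b = ad_cl e u].

Definition at_act (q : tangentm E) (h : H) : tangentm E :=
  (ract q.1 h, mderiv (fun e : E => ract e h) q.1 q.2).

Definition At := quot at_act.

Definition at_cl (e : E) (v : 'rV[C]_(n + m)) : At := cl at_act (e, v).

Definition at_proj (a : At) : X := pproj (rep a).1.

(** Value at [e] of the fundamental vector field of [u]. *)
Definition vert (e : E) (u : 'rV[C]_m) : 'rV[C]_(n + m) :=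
  mderiv (M := H) (N := E) (fun h => ract e h) 1%g u.

Definition iota2 (b : ad) : At := at_cl (rep b).1 (vert (rep b).1 (rep b).2).
End AdAt.

Section Extension.
Variables (n m k : nat) (X : manifold n) (H : liegroup m) (G : liegroup k).
Variables (i : H -> G) (E : pbundle X H).

(** E x^H G, elements of which are classes [e, g]. *)
Definition ext_act (q : E * G) (h : H) : E * G :=
  (ract q.1 h, (i h)^-1 * q.2)%g.

Definition ext_pt := quot ext_act.

Definition ext_proj (z : ext_pt) : X := pproj (rep z).1.

(** The trivialization of [E] around [x] identifies [e, g] with
    (p e, i (triv_fib x e) g). *)
Definition ext_fib (x : X) (z : ext_pt) : G :=
  (i (triv_fib x (rep z).1) * (rep z).2)%g.

Definition ext_chart (z : ext_pt) : chart ext_pt (n + k) :=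
  let x := ext_proj z in
  let c := chart_at x in
  let d := chart_at (ext_fib x z : lgm G) in
  Chart [set w | [/\ triv_dom E x (ext_proj w), cdom c (ext_proj w) &
                     cdom d (ext_fib x w)]]
    (fun w => row_mx (cmap c (ext_proj w)) (cmap d (ext_fib x w)))
    (fun y => cl ext_act (triv_sec E x (cinv c (lsubmx y)),
                          cinv d (rsubmx y))).

Definition ext : pbundle X G :=
  @PBundle n k X G (Manifold ext_chart) ext_proj
    (fun z g => cl ext_act ((rep z).1, (rep z).2 * g)%g)
    (triv_dom E)
    (fun x y => cl ext_act (triv_sec E x y, 1%g))
    ext_fib.

Definition ext_in (e : E) : ext := cl ext_act (e, 1%g).

Definition lie_in : 'rV[C]_m -> 'rV[C]_k := mderiv (M := H) (N := G) i 1%g.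

Definition iota1 (b : ad E) : ad ext :=
  ad_cl (ext_in (rep b).1) (lie_in (rep b).2).
End Extension.

Section Curvature.
Variables (n k : nat) (X : manifold n) (G : liegroup k) (E : pbundle X G).
Variable D : At E -> ad E.

(** The Lie algebra valued 1-form on [E] defined by [D]. *)
Definition conn_form (z : E) (v : 'rV[C]_(n + k)) : 'rV[C]_k :=
  ad_coord z (D (at_cl z v)).

(** Exterior derivative of [conn_form] at [z], computed in [chart_at z]. *)
Definition conn_d (z : E) (u v : 'rV[C]_(n + k)) : 'rV[C]_k :=
  let c := chart_at z in
  let w t y := conn_form (cinv c y) (of_chart c y t) in
  'd (w v) (cmap c z) u - 'd (w u) (cmap c z) v.

(** The curvature d w + 1/2 [w, w], w = [conn_form], as a section of ad(E),
    pulled back to [E]: [curv z u v] is its value on the images of u, v in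
    T_(p z) X. *)
Definition curv (z : E) (u v : 'rV[C]_(n + k)) : ad E :=
  ad_cl z (conn_d z u v + lie_bracket G (conn_form z u) (conn_form z v)).
End Curvature.

Section Cartan.
Variables (n m k : nat) (X : manifold n) (H : liegroup m) (G : liegroup k).
Variable i : H -> G.

(** [bcg_conn], the connection theta' on E_G, is determined by
    [bcg_form] = theta through [bcg_conn_def]: it maps the class of (v, w) to
    theta(v) + w, At(E_G) being the quotient of At(E_H) (+) ad(E_G) by ad(E_H).
    Fibrewise statements are read in the frames [ext_in e], e in E_H. *)
Record branched_cartan := BranchedCartan {
  bcg_bundle : pbundle X H;
  bcg_form : At bcg_bundle -> ad (ext i bcg_bundle);
  bcg_conn : At (ext i bcg_bundle) -> ad (ext i bcg_bundle);
  bcg_bundleP : is_pbundle bcg_bundle;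
  bcg_linear : forall e : bcg_bundle,
    exists L : {linear 'rV[C]_(n + m) -> 'rV[C]_k},
    forall v, bcg_form (at_cl e v) = ad_cl (ext_in i e) (L v);
  bcg_holo : holo_quot bcg_form;
  bcg_iso : exists U : set X, [/\ open (U : set (mpt X)), U !=set0 &
    forall x, U x ->
      set_bij [set a | at_proj a = x] [set b | ad_proj b = x] bcg_form];
  bcg_iota : forall b : ad bcg_bundle, bcg_form (iota2 b) = iota1 i b;
  bcg_conn_def : forall (e : bcg_bundle) v w,
    bcg_conn (at_cl (ext_in i e)
      (mderiv (M := bcg_bundle) (ext_in i (E := bcg_bundle)) e v +
       vert (ext_in i e) w)) =
    ad_cl (ext_in i e) (ad_coord (ext_in i e) (bcg_form (at_cl e v)) + w) }.

Arguments bcg_form : clear implicits.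
Arguments bcg_conn : clear implicits.

Definition normal_cartan (B : branched_cartan) : Prop :=
  forall z u v, range (iota1 i (E := bcg_bundle B)) (curv (bcg_conn B) z u v).

Definition flat_cartan (B : branched_cartan) : Prop :=
  forall z u v, curv (bcg_conn B) z u v = ad_cl z 0.
End Cartan.

Section PGL.
Variable n : nat.

Definition GL := {A : 'M[C]_n.+1 | A \in unitmx}.
Definition scalars := {c : C | c != 0}.

Definition toGL (A : 'M[C]_n.+1) (uA : A \in unitmx) : GL :=
  exist (fun A => is_true (A \in unitmx)) A uA.
Definition toscalars (c : C) (c0 : c != 0) : scalars :=
  exist (fun c => is_true (c != 0)) c c0.

Lemma GL_scale_subproof (A : GL) (c : scalars) : val c *: val A \in unitmx.
Proof.
by rewrite unitmxZ ?unitfE; [exact: valP | exact: (valP c)].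
Qed.

Definition GL_scale (A : GL) (c : scalars) : GL := toGL (GL_scale_subproof A c).

Definition PGL := quot GL_scale.

Definition GL1 : GL := toGL (unitmx1 C n.+1).

Lemma GL_mul_subproof (A B : GL) : val A *m val B \in unitmx.
Proof. by rewrite unitmx_mul (valP A) (valP B). Qed.

Definition GL_mul (A B : GL) : GL := toGL (GL_mul_subproof A B).

Lemma GL_inv_subproof (A : GL) : invmx (val A) \in unitmx.
Proof. by rewrite unitmx_inv (valP A). Qed.

Definition GL_inv (A : GL) : GL := toGL (GL_inv_subproof A).

Definition PGL_cl : GL -> PGL := cl GL_scale.
Definition PGL_mul (g h : PGL) := PGL_cl (GL_mul (rep g) (rep h)).
Definition PGL_inv (g : PGL) := PGL_cl (GL_inv (rep g)).

Lemma PGL_clP (A B : GL) :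
  PGL_cl A = PGL_cl B <-> exists2 c, c != 0 & val B = c *: val A.
Proof.
split=> [AB|[c c0 E]].
  have E := cl_inj AB.
  have : range (GL_scale B) B.
    exists (toscalars (oner_neq0 C)) => //.
    by apply: val_inj; rewrite /= scale1r.
  by rewrite -E => -[c _ <-]; exists (val c) => //; exact: (valP c).
apply: cl_eq; apply/seteqP; split=> _ [d _ <-].
  have dc0 : val d / c != 0 by rewrite mulf_neq0 ?invr_eq0 ?(valP d).
  exists (toscalars dc0) => //; apply: val_inj.
  by rewrite /= E scalerA divfK.
have dc0 : val d * c != 0 by rewrite mulf_neq0 ?(valP d).
exists (toscalars dc0) => //; apply: val_inj.
by rewrite /= E scalerA.
Qed.

Lemma PGL_repP (A : GL) :
  exists2 c, c != 0 & val A = c *: val (rep (PGL_cl A)).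
Proof. by apply/PGL_clP; rewrite /PGL_cl repK. Qed.

Lemma PGL_ind (P : PGL -> Prop) : (forall A, P (PGL_cl A)) -> forall g, P g.
Proof. by move=> PA g; rewrite -(repK g); exact: PA. Qed.

Lemma PGL_mulE (A B : GL) :
  PGL_mul (PGL_cl A) (PGL_cl B) = PGL_cl (GL_mul A B).
Proof.
have [a a0 Ea] := PGL_repP A; have [b b0 Eb] := PGL_repP B.
apply/PGL_clP; exists (a * b); first by rewrite mulf_neq0.
by rewrite /= Ea Eb -scalemxAl -scalemxAr scalerA.
Qed.

Lemma PGL_invE (A : GL) : PGL_inv (PGL_cl A) = PGL_cl (GL_inv A).
Proof.
have [a a0 Ea] := PGL_repP A.
apply/PGL_clP; exists a^-1; first by rewrite invr_eq0.
by rewrite /= Ea invmxZ // -Ea; exact: (valP A).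
Qed.

Lemma PGL_mulA : associative PGL_mul.
Proof.
elim/PGL_ind=> A; elim/PGL_ind=> B; elim/PGL_ind=> D.
by rewrite !PGL_mulE; congr PGL_cl; apply: val_inj; rewrite /= mulmxA.
Qed.

Lemma PGL_mul1g : left_id (PGL_cl GL1) PGL_mul.
Proof.
elim/PGL_ind=> A; rewrite PGL_mulE; congr PGL_cl.
by apply: val_inj; rewrite /= mul1mx.
Qed.

Lemma PGL_mulg1 : right_id (PGL_cl GL1) PGL_mul.
Proof.
elim/PGL_ind=> A; rewrite PGL_mulE; congr PGL_cl.
by apply: val_inj; rewrite /= mulmx1.
Qed.

Lemma PGL_mulVg : left_inverse (PGL_cl GL1) PGL_inv PGL_mul.
Proof.
elim/PGL_ind=> A; rewrite PGL_invE PGL_mulE; congr PGL_cl.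
by apply: val_inj; rewrite /= mulVmx // (valP A).
Qed.

Lemma PGL_mulgV : right_inverse (PGL_cl GL1) PGL_inv PGL_mul.
Proof.
elim/PGL_ind=> A; rewrite PGL_invE PGL_mulE; congr PGL_cl.
by apply: val_inj; rewrite /= mulmxV // (valP A).
Qed.

HB.instance Definition _ := gen_eqMixin PGL.
HB.instance Definition _ := gen_choiceMixin PGL.
HB.instance Definition _ := isGroup.Build PGL
  PGL_mulA PGL_mul1g PGL_mulg1 PGL_mulVg PGL_mulgV.

Definition rmx (g : PGL) : 'M[C]_n.+1 := val (rep g).

(** On the open set of classes of matrices A with A i j != 0, the coordinates
    are the entries of A / A i j other than the (i, j) one. *)
Definition PGL_affine (i j : 'I_n.+1) : chart PGL (n.+1 * n.+1).-1 :=
  let l := mxvec_index i j in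
  Chart [set g | rmx g i j != 0]
    (fun g => col' l (mxvec ((rmx g i j)^-1 *: rmx g)))
    (fun y => PGL_cl (insubd GL1
       (vec_mx (\row_s (if unlift l s is Some t then y 0 t else 1))))).

Definition PGL_chart (g : PGL) : chart PGL (n.+1 * n.+1).-1 :=
  let ij := odflt (0, 0)
    [pick s : 'I_n.+1 * 'I_n.+1 | rmx g s.1 s.2 != 0] in
  PGL_affine ij.1 ij.2.

Definition PGL_lie : liegroup (n.+1 * n.+1).-1 := LieGroup PGL_chart.

Definition nzvec := {v : 'cV[C]_n.+1 | v != 0}.

Definition tonzvec (v : 'cV[C]_n.+1) (v0 : v != 0) : nzvec :=
  exist (fun v => is_true (v != 0)) v v0.

Lemma nzvec_scale_subproof (v : nzvec) (c : scalars) : val c *: val v != 0.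
Proof. by rewrite scaler_eq0 negb_or (valP c) (valP v). Qed.

Definition nzvec_scale (v : nzvec) (c : scalars) : nzvec :=
  tonzvec (nzvec_scale_subproof v c).

Definition projspace := quot nzvec_scale.

Lemma GL_app_subproof (A : GL) (v : nzvec) : val A *m val v != 0.
Proof.
apply: contraNneq (valP v) => E.
by rewrite -(mulKmx (valP A) (val v)) E mulmx0.
Qed.

Definition GL_app (A : GL) (v : nzvec) : nzvec := tonzvec (GL_app_subproof A v).

Definition PGL_app (g : PGL) (p : projspace) : projspace :=
  cl nzvec_scale (GL_app (rep g) (rep p)).

Lemma base_vec_subproof : (delta_mx 0 0 : 'cV[C]_n.+1) != 0.
Proof.
apply/eqP => /matrixP /(_ 0 0); rewrite !mxE !eqxx /= => /eqP.
by rewrite oner_eq0.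
Qed.

Definition base_point : projspace :=
  cl nzvec_scale (tonzvec base_vec_subproof).

Lemma proj_clP (v w : nzvec) :
  cl nzvec_scale v = cl nzvec_scale w <-> exists2 c, c != 0 & val w = c *: val v.
Proof.
split=> [AB|[c c0 E]].
  have E := cl_inj AB.
  have : range (nzvec_scale w) w.
    exists (toscalars (oner_neq0 C)) => //.
    by apply: val_inj; rewrite /= scale1r.
  by rewrite -E => -[c _ <-]; exists (val c) => //; exact: (valP c).
apply: cl_eq; apply/seteqP; split=> _ [d _ <-].
  have dc0 : val d / c != 0 by rewrite mulf_neq0 ?invr_eq0 ?(valP d).
  exists (toscalars dc0) => //; apply: val_inj.
  by rewrite /= E scalerA divfK.
have dc0 : val d * c != 0 by rewrite mulf_neq0 ?(valP d).
exists (toscalars dc0) => //; apply: val_inj.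
by rewrite /= E scalerA.
Qed.

Lemma PGL_appE (A : GL) (v : nzvec) :
  PGL_app (PGL_cl A) (cl nzvec_scale v) = cl nzvec_scale (GL_app A v).
Proof.
have [a a0 Ea] := PGL_repP A.
have [b b0 Eb] : exists2 b, b != 0 &
    val v = b *: val (rep (cl nzvec_scale v)).
  by apply/proj_clP; rewrite repK.
apply/proj_clP; exists (a * b); first by rewrite mulf_neq0.
by rewrite /= Ea Eb -scalemxAl -scalemxAr scalerA.
Qed.

Lemma PGL_app1 (p : projspace) : PGL_app 1%g p = p.
Proof.
rewrite -(repK p) (PGL_appE GL1); congr cl.
by apply: val_inj; rewrite /= mul1mx.
Qed.

Lemma PGL_appM (g h : PGL) (p : projspace) :
  PGL_app (g * h)%g p = PGL_app g (PGL_app h p).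
Proof.
elim/PGL_ind: g => A; elim/PGL_ind: h => B; rewrite -(repK p).
have -> : (PGL_cl A * PGL_cl B)%g = PGL_cl (GL_mul A B) by exact: PGL_mulE.
rewrite !PGL_appE; congr cl.
by apply: val_inj; rewrite /= mulmxA.
Qed.

Definition stab_base : {pred PGL} :=
  fun g => `[< PGL_app g base_point = base_point >].

Lemma stab_base_closed : group_closed stab_base.
Proof.
split=> [|g h /asboolP gP /asboolP hP]; apply/asboolP; first exact: PGL_app1.
have hV : PGL_app h^-1%g base_point = base_point.
  by rewrite -[in LHS]hP -PGL_appM mulVg PGL_app1.
by rewrite PGL_appM hV gP.
Qed.

Definition stab := {g : PGL | stab_base g}.
HB.instance Definition _ := SubChoice.on stab.
HB.instance Definition _ :=
  SubChoice_isSubGroup.Build PGL stab_base stab stab_base_closed.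

(** An element of the stabilizer is represented by a unique matrix of the form
    (1 r; 0 A), and (r, A) are global coordinates. *)
Definition stab_chart (h : stab) : chart stab (n + n * n) :=
  Chart setT
    (fun g => let A : 'M[C]_(1 + n) := rmx (val g) in
       let B := (A 0 0)^-1 *: A in row_mx (ursubmx B) (mxvec (drsubmx B)))
    (fun y => insubd (1%g : stab) (PGL_cl (insubd GL1
       (block_mx 1 (lsubmx y) 0 (vec_mx (rsubmx y)) : 'M[C]_(1 + n))))).

Definition stab_lie : liegroup (n + n * n) := LieGroup stab_chart.

Definition stab_in (h : stab_lie) : PGL_lie := val (h : stab).
End PGL.

End Manifolds.

(* Main.v *)
(** On the torus X = C^2/Z[i]^2 take the trivial bundle E_H = X x H.  A constant
    gl(3)-valued 1-form omega = A dz1 + B dz2 plus the Maurer-Cartan form is a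
    connection on X x G; its restriction to E_H is a Cartan geometry as soon as
    omega induces an isomorphism TX -> g/h, and its curvature is
    [A, B] dz1 /\ dz2.  With A = E10 and B = E20 + E02 the first columns of A and
    B span g/h and [A, B] = E12 is a nonzero element of h. *)

Require Import Defs.
From HB Require Import structures.
From mathcomp Require Import all_boot all_order all_algebra.
From mathcomp Require Import all_classical all_reals all_analysis.
From mathcomp Require Import complex ring lra.

Set Implicit Arguments.
Unset Strict Implicit.
Unset Printing Implicit Defensive.

Import Order.TTheory GRing.Theory Num.Theory.
Import numFieldNormedType.Exports.
Local Open Scope classical_set_scope.
Local Open Scope ring_scope.

(** * Differential calculus on matrices *)

(** The summand E02 of B is what breaks flatness: E10 and E20 commute, while E02, lying in h, adds
    E10 E02 = E12 to the commutator without touching the isomorphism onto g/h. The branching locus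
    is empty: theta is an isomorphism over all of X. The difficulty is that bundles are quotients
    with chosen representatives, and charts jump from point to point, whereas the exterior
    derivative of the connection form lives in one chart. For X and H the transitions are locally
    translations, so a tangent vector has the same coordinates in all charts. The atlas of PGL is
    not of this kind. Its points are represented by matrices N, determined up to a scalar function
    f; replacing N by fN changes N^-1 dN by the scalar matrix df/f, which dies in pgl, and leaves
    Ad(N^-1) w unchanged. So the form Ad(N^-1) w + N^-1 dN, with w = omega, can be computed from any
    lift, in particular from the holomorphic lift given by one fixed chart. In the curvature the
    Maurer-Cartan terms cancel and Ad(N^-1) of the commutator of w remains. *)

Section Calculus.
Variable C : numFieldType.

(** Unfolding the little-o makes the condition visibly local, which [is_diff_near] exploits. *)
Lemma is_diffP (V W : normedModType C) (f : V -> W) (df : {linear V -> W}) x :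
  is_diff x f df <-> continuous df /\
    forall e : C, 0 < e -> \forall h \near (0 : V),
      `|f (h + x) - (f x + df h)| <= e * `|h|.
Proof.
split=> [[dfx dfE]|[dfc dfx]].
  split; first by rewrite -dfE; exact: diff_continuous.
  have /diff_locally/eqaddoP := dfx.
  by rewrite dfE => H e e0; have := H _ e0.
have H : f \o shift x = cst (f x) + df +o_ (0 : V) id.
  by apply/eqaddoP => e e0; exact: dfx.
have dE := diff_unique dfc H.
by apply: DiffDef => //; apply/diff_locallyP; rewrite dE.
Qed.

Lemma is_diff_near (V W : normedModType C) (f g : V -> W) (df : V -> W) x :
  (\forall y \near x, f y = g y) -> is_diff x f df -> is_diff x g df.
Proof.
move=> fg dfx; have := dfx; case=> _ dfE.
have : is_diff x f ('d f x) by apply: DiffDef => //; exact: ex_diff.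
rewrite -dfE => /is_diffP [dfc H]; apply/is_diffP; split=> // e e0.
have fgx : f x = g x by exact: nbhs_singleton fg.
have /= : \forall h \near 0, f (h + x) = g (h + x).
  by move: fg; rewrite (near_shift 0) /= subr0.
move=> fg'; near=> h.
have <- : f (h + x) = g (h + x) by near: h.
by rewrite -fgx; near: h; exact: H.
Unshelve. all: by end_near. Qed.

Lemma differentiable_near (V W : normedModType C) (f g : V -> W) (df : V -> W) x :
  (\forall y \near x, f y = g y) -> is_diff x f df -> differentiable g x.
Proof. by move=> fg dfx; have [] := is_diff_near fg dfx. Qed.

Lemma is_diff_ext (V W : normedModType C) (f df dg : V -> W) x :
  is_diff x f df -> (forall v, df v = dg v) -> is_diff x f dg.
Proof. by move=> dfx /funext <-. Qed.

(* The next three are stated for matrices so that the operations on the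
   differentials are those of matrices, not of a generic normed module. *)
Lemma is_diff_const (V : normedModType C) m n (a : 'M[C]_(m, n)) (x : V) :
  is_diff x (fun=> a) (fun=> 0).
Proof. exact: is_diff_cst. Qed.

Lemma is_diff_add (V : normedModType C) m n (f df g dg : V -> 'M[C]_(m, n)) x :
  is_diff x f df -> is_diff x g dg ->
  is_diff x (fun y => f y + g y) (fun v => df v + dg v).
Proof. by move=> dfx dgx; exact: is_diffD. Qed.

Lemma is_diff_sub (V : normedModType C) m n (f df g dg : V -> 'M[C]_(m, n)) x :
  is_diff x f df -> is_diff x g dg ->
  is_diff x (fun y => f y - g y) (fun v => df v - dg v).
Proof. by move=> dfx dgx; exact: is_diffB. Qed.

Lemma is_diff_sum (V W : normedModType C) (I : Type) (r : seq I)
  (f df : I -> V -> W) x : (forall i, is_diff x (f i) (df i)) ->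
  is_diff x (fun y => \sum_(i <- r) f i y) (fun v => \sum_(i <- r) df i v).
Proof.
move=> H; elim: r => [|i r IH].
  have -> : (fun y => \sum_(i <- [::]) f i y) = cst 0.
    by apply/funext => y; rewrite big_nil.
  have -> : (fun v => \sum_(i <- [::]) df i v) = 0.
    by apply/funext => y; rewrite big_nil.
  exact: is_diff_cst.
have -> : (fun y => \sum_(j <- i :: r) f j y) =
          f i + (fun y => \sum_(j <- r) f j y).
  by apply/funext => y; rewrite big_cons.
have -> : (fun y => \sum_(j <- i :: r) df j y) =
          df i + (fun y => \sum_(j <- r) df j y).
  by apply/funext => y; rewrite big_cons.
exact: is_diffD.
Qed.

Lemma is_diff_mx (V : normedModType C) m n (f df : V -> 'M[C]_(m, n)) x :
  (forall i j, is_diff x (fun y => f y i j : C) (fun v => df v i j)) ->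
  is_diff x f df.
Proof.
move=> H.
(* In the basis of elementary matrices, [f] is a finite sum of scalar functions times constant
   matrices. *)
have E (g : V -> 'M[C]_(m, n)) : g = fun y => \sum_(ij : 'I_m * 'I_n)
    g y ij.1 ij.2 *: delta_mx ij.1 ij.2.
  apply/funext => y; rewrite [LHS]matrix_sum_delta pair_bigA /=.
  by apply: eq_bigr => -[].
rewrite (E f) (E df); apply: is_diff_sum => -[i j] /=.
exact: (@is_diff_comp _ _ _ _ (fun y => f y i j : C) (fun v => df v i j)
  ( *:%R ^~ (delta_mx i j : 'M[C]_(m, n))) ( *:%R ^~ (delta_mx i j)) x).
Qed.

Lemma is_diff_coord m n (M : 'M[C]_(m, n)) i j :
  is_diff M (fun N : 'M[C]_(m, n) => N i j : C) (fun N => N i j).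
Proof.
have @f : {linear 'M[C]_(m, n) -> C}.
  by exists (fun N : 'M[C]_(_, _) => N i j); do 2![eexists]; do ?[constructor];
     rewrite ?mxE// => ? *; rewrite ?mxE//; move=> ?; rewrite !mxE.
rewrite (_ : (fun _ => _) = f) //; apply: DiffDef.
  exact/linear_differentiable/coord_continuous.
by rewrite diff_lin //; exact: coord_continuous.
Qed.

Lemma is_diff_comp_coord (V : normedModType C) m n (f df : V -> 'M[C]_(m, n)) x
  i j : is_diff x f df -> is_diff x (fun y => f y i j : C) (fun v => df v i j).
Proof.
move=> H; have G := is_diff_coord (f x) i j.
exact: (is_diff_comp H G).
Qed.

(** Continuity of [f] has to be earned: expanding in elementary matrices makes [f] a finite sum of
    coordinates times constants. *)
Lemma is_diff_linear m n p q (f : 'M[C]_(m, n) -> 'M[C]_(p, q)) x :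
  linear f -> is_diff x f f.
Proof.
move=> lf; pose fM := GRing.isLinear.Build _ _ _ _ _ lf.
pose fL : {linear _ -> _} := HB.pack f fM.
have E y : f y = \sum_(ij : 'I_m * 'I_n) y ij.1 ij.2 *: f (delta_mx ij.1 ij.2).
  rewrite [in LHS](matrix_sum_delta y) pair_bigA /=.
  transitivity (\sum_(ij : 'I_m * 'I_n) fL (y ij.1 ij.2 *: delta_mx ij.1 ij.2)).
    by rewrite -(linear_sum fL).
  by apply: eq_bigr => ij _; rewrite linearZZ.
rewrite (_ : f = fun y => \sum_(ij : 'I_m * 'I_n)
  y ij.1 ij.2 *: f (delta_mx ij.1 ij.2)); last exact/funext.
apply: is_diff_sum => -[i j] /=; have G := is_diff_coord x i j.
exact: (is_diff_comp G (is_diff_scalel (x i j) (f (delta_mx i j)))).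
Qed.

Lemma is_diff_mulmx (V : normedModType C) m n p
  (f df : V -> 'M[C]_(m, n)) (g dg : V -> 'M[C]_(n, p)) x :
  is_diff x f df -> is_diff x g dg ->
  is_diff x (fun y => f y *m g y) (fun v => df v *m g x + f x *m dg v).
Proof.
move=> fx gx; apply: is_diff_mx => i j.
have -> : (fun y => (f y *m g y) i j : C) =
    fun y => \sum_k ((fun y => f y i k : C) * (fun y => g y k j : C)) y.
  by apply/funext => y; rewrite mxE.
have -> : (fun v => (df v *m g x + f x *m dg v) i j) =
    fun v => \sum_k (f x i k *: (fun v => dg v k j : C)
                     + g x k j *: (fun v => df v i k : C)) v.
  apply/funext => v; rewrite !mxE -big_split; apply: eq_bigr => k _ /=.
  by rewrite addrC [X in _ + X = _]mulrC.
apply: is_diff_sum => k; apply: is_diffM; exact: is_diff_comp_coord.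
Qed.

Lemma is_diff_scalemx (V : normedModType C) m n
  (a da : V -> C) (f df : V -> 'M[C]_(m, n)) x :
  is_diff x a da -> is_diff x f df ->
  is_diff x (fun y => a y *: f y) (fun v => da v *: f x + a x *: df v).
Proof.
move=> ax fx; apply: is_diff_mx => i j.
have -> : (fun y => (a y *: f y) i j : C) = a * (fun y => f y i j : C).
  by apply/funext => y; rewrite mxE.
have -> : (fun v => (da v *: f x + a x *: df v) i j) =
   a x *: (fun v => df v i j : C) + f x i j *: da.
  by apply/funext => v; rewrite !mxE addrC [X in _ + X = _]mulrC.
by apply: is_diffM; exact: is_diff_comp_coord.
Qed.

Lemma is_diff_inv (V : normedModType C) (a da : V -> C) x :
  a x != 0 -> is_diff x a da ->
  is_diff x (fun y => (a y)^-1) (fun v => - (a x) ^- 2 * da v).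
Proof.
move=> a0 H; have G := @diff_Rinv _ (a x) a0.
have K : is_diff (a x) (GRing.inv : C -> C) (fun h : C => - (a x) ^- 2 *: h).
  by apply: DiffDef => //; exact: differentiable_Rinv.
exact: (is_diff_comp H K).
Qed.

Lemma differentiable_prod (V : normedModType C) (I : Type) (r : seq I)
  (f : I -> V -> C) x : (forall i, differentiable (f i) x) ->
  differentiable (fun y => \prod_(i <- r) f i y) x.
Proof.
move=> H; elim: r => [|i r IH].
  rewrite (_ : (fun _ => _) = cst 1); first exact: differentiable_cst.
  by apply/funext => y; rewrite big_nil.
rewrite (_ : (fun _ => _) = f i * (fun y => \prod_(j <- r) f j y)).
  exact: differentiableM.
by apply/funext => y; rewrite big_cons.
Qed.

Lemma differentiable_bigsum (V W : normedModType C) (I : Type) (r : seq I)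
  (f : I -> V -> W) x : (forall i, differentiable (f i) x) ->
  differentiable (fun y => \sum_(i <- r) f i y) x.
Proof.
move=> H; have H' i : is_diff x (f i) ('d (f i) x) by exact: differentiableP.
by have := is_diff_sum r H'; case.
Qed.

Lemma differentiable_mx (V : normedModType C) m n (f : V -> 'M[C]_(m, n)) x :
  (forall i j, differentiable (fun y => f y i j : C) x) -> differentiable f x.
Proof.
move=> H.
pose df v := \matrix_(i, j) ('d (fun y => f y i j : C) x v : C).
have [] // : is_diff x f df.
apply: is_diff_mx => i j; rewrite (_ : (fun _ => df _ _ _) = 'd (fun y => f y i j : C) x).
  exact: differentiableP.
by apply/funext => v; rewrite mxE.
Qed.

Lemma differentiable_det n (f : 'M[C]_n -> 'M[C]_n) A :
  (forall i j, differentiable (fun B => f B i j : C) A) ->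
  differentiable (fun B => \det (f B) : C) A.
Proof.
move=> H; apply: differentiable_bigsum => s.
rewrite (_ : (fun _ => _) = (cst ((-1) ^+ perm.odd_perm s) : _ -> C) *
    (fun B => \prod_i f B i (perm.fun_of_perm s i))).
  by apply: differentiableM => //; exact: differentiable_prod.
by [].
Qed.

Lemma unitmx_near n (A : 'M[C]_n) : A \in unitmx ->
  \forall B \near A, B \in unitmx.
Proof.
rewrite unitmxE unitfE => dA.
have : {for A, continuous (fun B : 'M[C]_n => \det B)}.
  apply: differentiable_continuous; apply: differentiable_det => i j.
  exact: differentiable_coord.
move=> /cvgr_neq0 /(_ dA); apply: filterS => B.
by rewrite unitmxE unitfE.
Qed.

(** The cofactor formula for [invmx] is valid only on invertible matrices, but these form a
    neighbourhood of [A]. *)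
Lemma differentiable_invmx n (A : 'M[C]_n) : A \in unitmx ->
  differentiable (@invmx C n) A.
Proof.
move=> uA; have dA : \det A != 0 by move: uA; rewrite unitmxE unitfE.
have dd : differentiable (fun B : 'M[C]_n => \det B : C) A.
  by apply: differentiable_det => i j; exact: differentiable_coord.
have H : differentiable (fun B : 'M[C]_n => (\det B)^-1 *: \adj B) A.
  apply: differentiable_mx => i j.
  rewrite (_ : (fun _ => _) = (fun B => (\det B)^-1 : C) *
     ((cst ((-1) ^+ (j + i)) : _ -> C) * (fun B => \det (row' j (col' i B)) : C))).
    apply: differentiableM; first exact: differentiableV.
    apply: differentiableM => //; apply: differentiable_bigsum => s.
    apply: differentiableM => //; apply: differentiable_prod => k.
    rewrite (_ : (fun _ => _) =
      (fun B : 'M[C]_n => B (lift j k) (lift i (perm.fun_of_perm s k)) : C)).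
      exact: differentiable_coord.
    by apply/funext => B; rewrite !mxE.
  by apply/funext => B; rewrite !mxE.
have [] // : is_diff A (@invmx C n) ('d (fun B : 'M[C]_n => (\det B)^-1 *: \adj B) A).
apply: is_diff_near (differentiableP H).
by near=> B; rewrite /invmx; have -> : B \in unitmx by near: B; exact: unitmx_near.
Unshelve. all: by end_near. Qed.

(* Differentiate [A^-1 A = 1]. *)
Lemma is_diff_invmx (V : normedModType C) n (f df : V -> 'M[C]_n) x :
  f x \in unitmx -> is_diff x f df ->
  is_diff x (fun y => invmx (f y))
    (fun v => - (invmx (f x) *m df v *m invmx (f x))).
Proof.
move=> ux fx; have di : differentiable (@invmx C n \o f) x.
  by apply: differentiable_comp; [exact: ex_diff|exact: differentiable_invmx].
have /differentiableP dx := di.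
have P := is_diff_mulmx dx fx.
have : is_diff x (cst (1%:M : 'M[C]_n))
   (fun v => 'd (@invmx C n \o f) x v *m f x + (@invmx C n \o f) x *m df v).
  apply: is_diff_near P; near=> y; rewrite /= mulVmx //; near: y.
  have /(_ _ (unitmx_near ux)) : {for x, continuous f}.
    by apply: differentiable_continuous; exact: ex_diff.
  by move=> H; exact: H.
move=> H1; have E v : 'd (@invmx C n \o f) x v *m f x = - (invmx (f x) *m df v).
  have E1 := congr1 (fun g : V -> 'M[C]_n => g v) (@diff_val _ _ _ _ _ _ _ H1).
  have E0 := congr1 (fun g : V -> 'M[C]_n => g v)
    (@diff_cst C V _ (1%:M : 'M[C]_n) x).
  by apply/eqP; rewrite -addr_eq0; apply/eqP; exact: (etrans (esym E1) E0).
apply: (@DiffDef _ _ _ _ _ (fun y => invmx (f y))); first exact: di.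
apply/funext => v; rewrite -mulNmx -E mulmxK //.
Unshelve. all: by end_near. Qed.

End Calculus.

(** * Atlases whose transitions are locally translations *)

Section FlatAtlas.
Variable C : numFieldType.

(* All that is needed of the target of a map that is to be shown holomorphic. *)
Definition weak_atlas n (M : manifold C n) : Prop :=
  (forall x : M, cdom (chart_at x) x) /\
  forall x p : M, cdom (chart_at x) p ->
    cinv (chart_at x) (cmap (chart_at x) p) = p.

(** The transitions are locally translations, so their differentials are the identity. The condition
    also makes the images of the charts open, through the equation [cmap (cinv t) = t] near each
    image point. *)
Definition flat_atlas n (M : manifold C n) : Prop :=
  weak_atlas M /\
  forall x y p : M, cdom (chart_at x) p -> cdom (chart_at y) p ->
    exists a, \forall t \near cmap (chart_at x) p,
      let q := cinv (chart_at x) t in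
      [/\ cdom (chart_at x) q, cmap (chart_at x) q = t,
          cdom (chart_at y) q & cmap (chart_at y) q = t + a].

Lemma flat_near n (M : manifold C n) (x p : M) : flat_atlas M ->
  cdom (chart_at x) p -> \forall t \near cmap (chart_at x) p,
    cdom (chart_at x) (cinv (chart_at x) t) /\
    cmap (chart_at x) (cinv (chart_at x) t) = t.
Proof.
move=> [_ fl] dp; have [a] := fl _ _ _ dp dp.
by apply: filterS => t [].
Qed.

Lemma near_addr n (s a : 'rV[C]_n) (P : set 'rV[C]_n) :
  (\forall t \near s + a, P t) -> \forall t \near s, P (t + a).
Proof.
rewrite (near_shift s); apply: filterS => t /=.
by rewrite addrAC subrr add0r.
Qed.

Lemma near_subst n (u v : 'rV[C]_n) (P : set 'rV[C]_n) :
  v = u -> (\forall t \near u, P t) -> \forall t \near v, P t.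
Proof. by move=> ->. Qed.

Lemma near_and n (u : 'rV[C]_n) (P Q : set 'rV[C]_n) :
  (\forall t \near u, P t) -> (\forall t \near u, Q t) ->
  \forall t \near u, P t /\ Q t.
Proof. exact: filterI. Qed.

Lemma ball_near n (a u : 'rV[C]_n) e :
  ball a e u -> \forall t \near u, ball a e t.
Proof.
move=> au; apply: open_nbhs_nbhs; split=> //.
by apply: ball_open; case: au.
Qed.

(** Open sets are tested in all charts at once; this reduces neighbourhoods of a point to a single
    chart around it. *)
Lemma flat_nbhsP n (M : manifold C n) (x p : M) (B : set (mpt M)) :
  flat_atlas M -> cdom (chart_at x) p ->
  nbhs (p : mpt M) B <->
  \forall t \near cmap (chart_at x) p, B (cinv (chart_at x) t).
Proof.
move=> fM dp; have [[dM cM] fl] := fM; split.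
  rewrite nbhsE => -[A [oA Ap] AB].
  by have := oA x p Ap dp; apply: filterS => t; exact: AB.
(* [U] is the interior of [B] as read in the chart at [x]. It is open when read in any other chart
   because translations carry neighbourhoods to neighbourhoods. *)
move=> nB; pose U : set (mpt M) := [set q | cdom (chart_at x) q /\
  \forall t \near cmap (chart_at x) q, B (cinv (chart_at x) t)].
have UB : U `<=` B.
  by move=> q [dq /nbhs_singleton]; rewrite cM.
apply: filterS UB _; apply: open_nbhs_nbhs; split; last by split.
move=> y q [dxq nq] dyq; have [a H] := fl _ _ _ dyq dxq.
have Ea : cmap (chart_at x) q = cmap (chart_at y) q + a.
  by have [] := nbhs_singleton H; rewrite cM.
have nq' : \forall s \near cmap (chart_at y) q,
    \forall t \near (s + a), B (cinv (chart_at x) t).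
  have := nbhs_interior nq; rewrite Ea.
  move: (cmap (chart_at y) q) => s0.
  exact: near_addr.
by apply: filterS2 H nq' => s [_ _ d E] Bs; split=> //; rewrite E.
Qed.

(** Continuity follows from differentiability of the local expression once [f] stays in the target
    chart. Only the source has to be flat, since maps into the bundle E_G occur as well. *)
Lemma holo_atI m n (M : manifold C m) (N : manifold C n) (f : M -> N) x :
  flat_atlas M -> weak_atlas N ->
  (\forall t \near cmap (chart_at x) x,
     cdom (chart_at (f x)) (f (cinv (chart_at x) t))) ->
  differentiable (wr f x) (cmap (chart_at x) x) -> holo_at f x.
Proof.
move=> fM [dN cN] nf df; have [[dM cM] _] := fM; split=> // A.
rewrite nbhsE => -[V [oV Vfx] VA].
apply/(flat_nbhsP _ fM (dM x)).
have wx : wr f x (cmap (chart_at x) x) = cmap (chart_at (f x)) (f x).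
  by rewrite /wr /= cM.
have nO : \forall t \near cmap (chart_at x) x, V (cinv (chart_at (f x)) (wr f x t)).
  have := oV (f x) (f x) Vfx (dN _); rewrite -wx.
  by move=> H; exact: (differentiable_continuous df H).
near=> t; apply: VA.
have <- : cinv (chart_at (f x)) (wr f x t) = f (cinv (chart_at x) t).
  by rewrite /wr /= cN //; near: t.
by near: t.
Unshelve. all: by end_near. Qed.

Lemma holoI m n (M : manifold C m) (N : manifold C n) (f : M -> N) :
  flat_atlas M -> weak_atlas N ->
  (forall x, \forall t \near cmap (chart_at x) x,
     cdom (chart_at (f x)) (f (cinv (chart_at x) t))) ->
  (forall x, differentiable (wr f x) (cmap (chart_at x) x)) -> holo f.
Proof.
by move=> fM wN nf df; split=> [|x _]; [exact: openT|exact: holo_atI].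
Qed.

Lemma near_row_mx m n (a : 'rV[C]_m) (b : 'rV[C]_n) (P Q : set _) :
  (\forall t \near a, P t) -> (\forall t \near b, Q t) ->
  \forall t \near row_mx a b, P (lsubmx t) /\ Q (rsubmx t).
Proof.
move=> nP nQ; near=> t; split; near: t.
  have := @continuous_lsubmx C 1 m n (row_mx a b).
  by rewrite /continuous_at row_mxKl => /(_ _ nP).
have := @continuous_rsubmx C 1 m n (row_mx a b).
by rewrite /continuous_at row_mxKr => /(_ _ nQ).
Unshelve. all: by end_near. Qed.

Lemma weak_atlas_prod m n (M : manifold C m) (N : manifold C n) :
  weak_atlas M -> weak_atlas N -> weak_atlas (prodm M N).
Proof.
move=> [dM cM] [dN cN]; split=> [[x y]|[x y] [p q]] /=; first by split.
by move=> [/= dp dq]; rewrite row_mxKl row_mxKr cM // cN.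
Qed.

Lemma flat_atlas_prod m n (M : manifold C m) (N : manifold C n) :
  flat_atlas M -> flat_atlas N -> flat_atlas (prodm M N).
Proof.
move=> [wM fM] [wN fN]; split; first exact: weak_atlas_prod.
move=> [x x'] [y y'] [p p'] [/= dp dp'] [/= dq dq'].
have [a Ha] := fM _ _ _ dp dq; have [b Hb] := fN _ _ _ dp' dq'.
exists (row_mx a b); have := near_row_mx Ha Hb; apply: filterS => t /=.
move=> [[d1 E1 d2 E2] [d3 E3 d4 E4]].
rewrite /= E1 E2 E3 E4; split=> //.
  exact: hsubmxK.
by rewrite -add_row_mx hsubmxK.
Qed.

Lemma is_diff_translation n (f : 'rV[C]_n -> 'rV[C]_n) a y :
  (\forall t \near y, f t = t + a) -> is_diff y f id.
Proof.
move=> H; apply: (@is_diff_near _ _ _ (id + cst a)).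
  by apply: filterS H => t /= ->.
by rewrite -[X in is_diff _ _ X]addr0; apply: is_diffD.
Qed.

Lemma flat_to_chart n (M : manifold C n) (x p : M) v : flat_atlas M ->
  cdom (chart_at x) p -> to_chart (chart_at x) p v = v.
Proof.
move=> [[dM cM] fM] dp; have [a Ha] := fM p x p (dM p) dp.
rewrite /to_chart; have [] // : is_diff (cmap (chart_at p) p)
  (cmap (chart_at x) \o cinv (chart_at p)) id.
  by apply: (@is_diff_translation _ _ a); apply: filterS Ha => t [].
by move=> _ ->.
Qed.

Lemma flat_of_chart n (M : manifold C n) (x p : M) v : flat_atlas M ->
  cdom (chart_at x) p -> of_chart (chart_at x) (cmap (chart_at x) p) v = v.
Proof.
move=> [[dM cM] fM] dp; have [a Ha] := fM x p p dp (dM p).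
rewrite /of_chart cM //; have [] // : is_diff (cmap (chart_at x) p)
  (cmap (chart_at p) \o cinv (chart_at x)) id.
  by apply: (@is_diff_translation _ _ a); apply: filterS Ha => t [].
by move=> _ ->.
Qed.

Lemma flat_of_chart_near n (M : manifold C n) (x p : M) : flat_atlas M ->
  cdom (chart_at x) p -> \forall t \near cmap (chart_at x) p,
    forall v, of_chart (chart_at x) t v = v.
Proof.
move=> fM dp; have := flat_near fM dp; apply: filterS => t [d E] v.
by rewrite -E flat_of_chart.
Qed.

(** A translation by [a] has differential the identity, so it induces the translation by (a, 0) on
    tangent vectors. *)
Lemma flat_atlas_tangent n (M : manifold C n) :
  flat_atlas M -> flat_atlas (tangentm M).
Proof.
move=> fM; have [[dM cM] fl] := fM; split.
  split=> [[x v]|[x v] [p w]] /=; first exact: dM.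
  by move=> dp; rewrite row_mxKl row_mxKr cM // flat_to_chart // flat_of_chart.
move=> [x v] [y w] [p u] /= dx dy; have [a Ha] := fl _ _ _ dx dy.
exists (row_mx a 0); rewrite flat_to_chart //.
have Hb : \forall t \near u, True by exact: filterE.
have Hc := near_row_mx (flat_of_chart_near fM dx) Hb.
have := near_row_mx Ha Hb; apply: filterS2 Hc => t /= [oc _] [[d1 E1 d2 E2] _].
rewrite E1 E2 oc !flat_to_chart //; split=> //; first exact: hsubmxK.
by rewrite -[t in RHS]hsubmxK add_row_mx addr0.
Qed.

Lemma flat_fst n m (M : manifold C n) (N : manifold C m) :
  flat_atlas M -> flat_atlas N -> holo (M := prodm M N) (N := M) fst.
Proof.
move=> fM fN; have fMN := flat_atlas_prod fM fN.
have [[dM _] _] := fM; have [[dN _] _] := fN.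
have H (x : prodm M N) : \forall t \near cmap (chart_at x) x,
   cdom (chart_at x.1) (cinv (chart_at x) t).1 /\
   cmap (chart_at x.1) (cinv (chart_at x) t).1 = lsubmx t.
  have := flat_near fMN (p := x) (conj (dM x.1) (dN x.2)).
  apply: filterS => t /= [[? ?] E]; split=> //.
  by rewrite -[in RHS]E row_mxKl.
apply: holoI => //; first by case: fM.
  by move=> x; apply: filterS (H x) => t [].
move=> x; have [] // : is_diff (cmap (chart_at x) x) (wr (fst : prodm M N -> M) x) lsubmx.
apply: (@is_diff_near _ _ _ lsubmx); last exact/is_diff_linear/linearP.
by apply: filterS (H x) => t [_ <-].
Qed.

Lemma flat_snd n m (M : manifold C n) (N : manifold C m) :
  flat_atlas M -> flat_atlas N -> holo (M := prodm M N) (N := N) snd.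
Proof.
move=> fM fN; have fMN := flat_atlas_prod fM fN.
have [[dM _] _] := fM; have [[dN _] _] := fN.
have H (x : prodm M N) : \forall t \near cmap (chart_at x) x,
   cdom (chart_at x.2) (cinv (chart_at x) t).2 /\
   cmap (chart_at x.2) (cinv (chart_at x) t).2 = rsubmx t.
  have := flat_near fMN (p := x) (conj (dM x.1) (dN x.2)).
  apply: filterS => t /= [[? ?] E]; split=> //.
  by rewrite -[in RHS]E row_mxKr.
apply: holoI => //; first by case: fN.
  by move=> x; apply: filterS (H x) => t [].
move=> x; have [] // : is_diff (cmap (chart_at x) x) (wr (snd : prodm M N -> N) x) rsubmx.
apply: (@is_diff_near _ _ _ rsubmx); last exact/is_diff_linear/linearP.
by apply: filterS (H x) => t [_ <-].
Qed.

(** The topology of [prodm] comes from its charts, not from the product topology; continuity of the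
    two projections is enough to separate points. *)
Lemma hausdorff_prodm n m (M : manifold C n) (N : manifold C m) :
  flat_atlas M -> flat_atlas N -> hausdorff_space (mpt M) ->
  hausdorff_space (mpt N) -> hausdorff_space (mpt (prodm M N)).
Proof.
move=> fM fN hM hN [p p'] [q q'] cl; congr (_, _).
  apply: hM => A B nA nB.
  have [cp _] := (flat_fst fM fN).2 (p, p') I.
  have [cq _] := (flat_fst fM fN).2 (q, q') I.
  by have [z [Az Bz]] := cl _ _ (cp _ nA) (cq _ nB); exists z.1.
apply: hN => A B nA nB.
have [cp _] := (flat_snd fM fN).2 (p, p') I.
have [cq _] := (flat_snd fM fN).2 (q, q') I.
by have [z [Az Bz]] := cl _ _ (cp _ nA) (cq _ nB); exists z.2.
Qed.

(** The basis consists of the balls, in countably many charts, with centre in a countable dense set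
    and radius 1/(r+1). Density and the archimedean property are hypotheses because [C] is an
    arbitrary [numFieldType]. *)
Lemma second_countable_flat n (M : manifold C n) (D : nat -> C) (s : nat -> M) :
  (forall (z e : C), 0 < e -> exists k, `|z - D k| < e) ->
  (forall e : C, 0 < e -> exists k, k.+1%:R^-1 < e) ->
  flat_atlas M -> (forall x, exists k, cdom (chart_at (s k)) x) ->
  @second_countable (mpt M).
Proof.
move=> dense arch fM cov; have [[dM cM] fl] := fM.
pose U (i : nat * 'rV[nat]_n * nat) : set (mpt M) :=
  [set p | cdom (chart_at (s i.1.1)) p /\
     ball (map_mx D i.1.2) (i.2.+1%:R^-1) (cmap (chart_at (s i.1.1)) p)].
exists (range U).
  by apply: (card_le_trans (card_image_le _ _)); exact: countableP.
split.
  move=> _ [[[k q] r] _ <-]; rewrite openE => p [/= dp bp].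
  apply/(flat_nbhsP _ fM dp).
  have r0 : 0 < r.+1%:R^-1 :> C by rewrite invr_gt0 ltr0n.
  have nb : \forall t \near cmap (chart_at (s k)) p, ball (map_mx D q) (r.+1%:R^-1) t.
    by apply: open_nbhs_nbhs; split=> //; exact: ball_open.
  apply: filterS2 nb (flat_near fM dp) => t bt [dt Et]; split=> //=.
  by rewrite Et.
move=> x A nA; have [k dk] := cov x.
have /(flat_nbhsP _ fM dk)/nbhs_ballP [e /= e0 eA] := nA.
(* Half of [e]: a ball of radius below e/2 that contains the image of [x] lies in the ball of radius
   [e] around it. *)
have [r re] := arch (e / 2) (divr_gt0 e0 (ltr0n _ 2)).
have r0 : 0 < r.+1%:R^-1 :> C by rewrite invr_gt0 ltr0n.
have [q hq] := choice (fun j => dense (cmap (chart_at (s k)) x 0 j) _ r0).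
pose Q := \row_j q j.
have bx : ball (map_mx D Q) (r.+1%:R^-1) (cmap (chart_at (s k)) x).
  split=> // i j; rewrite !mxE !ord1 /ball /= distrC; exact: hq.
exists (U (k, Q, r)); first by split=> //; exists (k, Q, r).
move=> p [/= dp bp]; rewrite -(cM _ _ dp); apply: eA.
apply: (@le_ball _ _ _ (r.+1%:R^-1 + r.+1%:R^-1)).
  by rewrite [e]splitr; apply: lerD; exact: ltW.
exact: ball_triangle (ball_sym bx) bp.
Qed.

Lemma flat_is_manifold n (M : manifold C n) : flat_atlas M ->
  hausdorff_space (mpt M) -> @second_countable (mpt M) -> is_manifold M.
Proof.
move=> fM hM sM; have [[dM cM] fl] := fM; split=> //.
move=> x y; split.
  rewrite openE => _ [p [dx dy] <-]; have [a] := fl _ _ _ dx dy.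
  apply: filterS => t [d1 E1 d2 E2]; exists (cinv (chart_at x) t) => //.
move=> p dx dy; have [a Ha] := fl _ _ _ dx dy.
have [] // : is_diff (cmap (chart_at x) p) (cmap (chart_at y) \o cinv (chart_at x)) id.
by apply: (@is_diff_translation _ _ a); apply: filterS Ha => t [].
Qed.

End FlatAtlas.

(** * The torus C^n / Z[i]^n *)

Section Torus.
Local Open Scope complex_scope.
Variables (R : realType) (n : nat).
Local Notation C := (R[i] : numFieldType).

Lemma normc_le_add (a b : R) : `|a +i* b| <= (`|a| + `|b|)%:C.
Proof.
rewrite normc_def lecR /=.
have -> : `|a| + `|b| = Num.sqrt ((`|a| + `|b|) ^+ 2).
  by rewrite sqrtr_sqr [RHS]ger0_norm // addr_ge0 // normr_ge0.
rewrite ler_sqrt ?sqr_ge0 // sqrrD !real_normK ?num_real //.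
by rewrite lerD2r lerDl mulrn_wge0 // mulr_ge0.
Qed.

Lemma normc_ge_Im (z : C) : `|complex.Im z|%:C <= `|z|.
Proof.
by case: z => a b; rewrite normc_def lecR -sqrtr_sqr ler_sqrt ?addr_ge0 ?sqr_ge0 //= lerDr sqr_ge0.
Qed.

Lemma gt0_real (e : C) : 0 < e -> exists2 r : R, 0 < r & e = r%:C.
Proof. by case: e => r s; rewrite ltcE /= => /andP[/eqP -> r0]; exists r. Qed.

Lemma complex_continuous : continuous (fun p : R * R => p.1 +i* p.2 : C).
Proof.
move=> p; apply/cvgrPdist_lt => e /gt0_real [r r0 ->].
have r2 : 0 < r / 2 by rewrite divr_gt0.
have /cvgrPdist_lt/(_ _ r2) n1 : (q.1 @[q --> p] --> p.1) by exact: cvg_fst.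
have /cvgrPdist_lt/(_ _ r2) n2 : (q.2 @[q --> p] --> p.2) by exact: cvg_snd.
apply: filterS2 n1 n2 => q q1 q2.
apply: (le_lt_trans (normc_le_add (p.1 - q.1) (p.2 - q.2))).
by rewrite ltcR [r]splitr ltrD.
Qed.

Lemma complex_dense : exists D : nat -> C,
  forall z e : C, 0 < e -> exists k, `|z - D k| < e.
Proof.
exists (fun k => if unpickle k is Some (a, b) then ratr a +i* ratr b else 0).
case=> x y _ /gt0_real [r r0 ->].
have r2 : 0 < r / 2 by rewrite divr_gt0.
have H (t : R) : exists q, `|t - ratr q| < r / 2.
  have : t - r / 2 < t + r / 2 by rewrite ltrD2l gtrN.
  move=> /rat_in_itvoo [q]; rewrite in_itv /= => /andP[q1 q2]; exists q.
  by rewrite ltr_norml; apply/andP; split; lra.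
have [[a Ha] [b Hb]] := (H x, H y).
exists (pickle (a, b)); rewrite pickleK.
apply: (le_lt_trans (normc_le_add (x - ratr a) (y - ratr b))).
by rewrite ltcR [r]splitr ltrD.
Qed.

Lemma complex_archimedean (e : C) : 0 < e -> exists k, k.+1%:R^-1 < e.
Proof.
move=> /gt0_real [r r0 ->].
have [k rk] := filter_ex (near_infty_natSinv_lt (PosNum r0)); exists k.
have -> : k.+1%:R^-1 = (k.+1%:R^-1 : R)%:C by rewrite fmorphV rmorph_nat.
by rewrite ltcR.
Qed.

Definition lattice := ('rV[int]_n * 'rV[int]_n)%type.

Definition lattice_vec (l : lattice) : 'rV[C]_n :=
  \row_j ((l.1 0 j)%:~R +i* (l.2 0 j)%:~R).

Lemma lattice_vecD l m : lattice_vec (l + m) = lattice_vec l + lattice_vec m.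
Proof. by apply/rowP => j; rewrite !mxE /= !intrD. Qed.

Lemma lattice_vecN l : lattice_vec (- l) = - lattice_vec l.
Proof. by apply/rowP => j; rewrite !mxE /= !intrN. Qed.

(** Discreteness of the lattice: real and imaginary parts of the coordinates are integers of
    absolute value below 1. *)
Lemma lattice_vec_lt1 l : `|lattice_vec l| < 1 -> lattice_vec l = 0.
Proof.
move=> l1; have : ball (0 : 'rV[C]_n) 1 (lattice_vec l).
  by rewrite -ball_normE /ball_ /= sub0r normrN.
move=> [_ H]; apply/rowP => j; have := H 0 j; rewrite !mxE /ball /= sub0r normrN.
set z := _ +i* _ => z1.
have zZ (a : int) : `|a%:~R : R|%:C <= `|z| -> a = 0.
  move=> /le_lt_trans /(_ z1); rewrite ltcR -intr_norm ltrz1 => a1.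
  by apply/eqP; rewrite -normr_eq0; case: `|a|%R a1 (normr_ge0 a) => // [[]].
by rewrite /z (zZ _ (normc_ge_Re z)) (zZ _ (normc_ge_Im z)).
Qed.

Definition lattice_act (z : 'rV[C]_n) (l : lattice) : 'rV[C]_n := z + lattice_vec l.

(* Locked: the unifier would otherwise unfold classes into sets of matrices. *)
Definition tpi : 'rV[C]_n -> quot lattice_act :=
  locked (cl lattice_act).

Lemma tpi_rep x : tpi (rep x) = x.
Proof. by rewrite /tpi -lock repK. Qed.

Lemma tpiD z l : tpi (z + lattice_vec l) = tpi z.
Proof.
rewrite /tpi -lock; apply: cl_eq; apply/seteqP; split=> _ [m _ <-].
  by exists (l + m) => //; rewrite /lattice_act lattice_vecD addrA.
by exists (- l + m) => //; rewrite /lattice_act lattice_vecD lattice_vecN addrA addrK.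
Qed.

Lemma tpiP z w : tpi z = tpi w -> exists l, w = z + lattice_vec l.
Proof.
rewrite /tpi -lock => zw; have E := cl_inj zw; have : range (lattice_act w) w.
  exists 0 => //; rewrite /lattice_act (_ : lattice_vec 0 = 0) ?addr0 //.
  by apply/rowP => j; rewrite !mxE.
by rewrite -E => -[l _ <-]; exists l.
Qed.

(** With radius 1/2, two points of the ball are at distance less than 1, so the projection is
    injective on it and the [xget] picks the only preimage. *)
Definition torus_chart (x : quot lattice_act) : chart C (quot lattice_act) n :=
  Chart (tpi @` ball (rep x) (2^-1 : C))
    (fun p => xget 0 [set y | ball (rep x) (2^-1 : C) y /\ tpi y = p]) tpi.

Definition torus : manifold C n := Manifold torus_chart.

Lemma half_half : 2^-1 + 2^-1 = 1 :> C.
Proof. by rewrite [RHS]splitr div1r. Qed.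

Lemma torus_cmap (x : torus) u : ball (rep x) (2^-1 : C) u ->
  cmap (chart_at x) (tpi u) = u.
Proof.
move=> xu; rewrite /=; case: xgetP => [y _ [xy /tpiP [l E]]|/(_ u)]; last by case.
have := ball_triangle (ball_sym xy) xu.
rewrite half_half -ball_normE /ball_ /= E opprD addrA subrr sub0r normrN => /lattice_vec_lt1 ->.
by rewrite addr0.
Qed.

Lemma complex_half_gt0 : 0 < (2^-1 : C). Proof. by rewrite invr_gt0. Qed.

Lemma torus_flat : flat_atlas torus.
Proof.
split; first split.
- by move=> x; exists (rep x); [exact: ballxx complex_half_gt0|exact: tpi_rep].
- by move=> x _ [u xu <-]; rewrite torus_cmap.
(* Two preimages of a point differ by a lattice vector, which near that point is the translation
   between the charts. *)
move=> x y _ [u xu <-] [w yw /esym/tpiP [l E]]; exists (lattice_vec l).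
apply: (near_subst (torus_cmap xu)).
have n1 : \forall t \near u, ball (rep x) (2^-1 : C) t by exact: ball_near.
have n2 : \forall t \near u, ball (rep y) (2^-1 : C) (t + lattice_vec l).
  by apply: near_addr; rewrite -E; exact: ball_near.
apply: filterS2 n1 n2 => t t1 t2 /=.
have Eq : tpi t = tpi (t + lattice_vec l) by rewrite tpiD.
split; [by exists t|exact: (torus_cmap t1)|rewrite Eq|rewrite Eq].
  by exists (t + lattice_vec l).
exact: (torus_cmap t2).
Qed.

(** The chart at [tpi y] is centred at the chosen representative of the class, which may be a
    lattice translate of [y]. *)
Lemma torus_cmapE (y : 'rV[C]_n) (x := tpi y : torus) :
  exists l, cmap (chart_at x) x = y + lattice_vec l.
Proof.
have E := torus_cmap (ballxx (rep x) complex_half_gt0).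
have xE : tpi (rep x) = x by exact: tpi_rep.
rewrite xE in E; rewrite E.
by apply: tpiP; rewrite xE.
Qed.

Lemma tpi_continuous : continuous (tpi : 'rV[C]_n -> mpt torus).
Proof.
move=> y B nB; have dx := torus_flat.1.1 (tpi y).
have [l E] := torus_cmapE y.
have := (flat_nbhsP _ torus_flat dx).1 nB; rewrite E => /near_addr.
by apply: filterS => t /=; rewrite tpiD.
Qed.

(** The projection is an open map. *)
Lemma tpi_nbhs (u : 'rV[C]_n) (V : set 'rV[C]_n) :
  nbhs u V -> nbhs (tpi u : mpt torus) (tpi @` V).
Proof.
move=> nV; have dx := torus_flat.1.1 (tpi u); have [l E] := torus_cmapE u.
apply/(flat_nbhsP _ torus_flat dx); rewrite E.
have : \forall t \near (u + lattice_vec l) + lattice_vec (- l), V t.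
  by rewrite lattice_vecN addrK.
move=> /near_addr; apply: filterS => t Vt.
by exists (t + lattice_vec (- l)) => //=; rewrite tpiD.
Qed.

Lemma torus_hausdorff : hausdorff_space (mpt torus).
Proof.
move=> p q cl; rewrite -(tpi_rep p) -(tpi_rep q).
set a := rep p; set b := rep q.
have {}cl (V W : set 'rV[C]_n) u w : tpi u = p -> tpi w = q -> nbhs u V ->
    nbhs w W -> exists v l, V v /\ W (v + lattice_vec l).
  move=> Eu Ew /tpi_nbhs; rewrite Eu => nV /tpi_nbhs; rewrite Ew => nW.
  by have [_ [[v Vv <-] [v' Wv' /esym/tpiP [l E]]]] := cl _ _ nV nW; exists v, l; rewrite -E.
have pa : tpi a = p by exact: tpi_rep.
have qb : tpi b = q by exact: tpi_rep.
(* If a translate of [b] is at distance r < 1/2 from [a] with r > 0, meeting balls of radius r/2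
   would force a lattice vector of norm below r + 1/2 to vanish, and then r < r. *)
have [[l Hl]|Hn] := pselect (exists l, `|b + lattice_vec l - a| < (2^-1 : C)).
  have [->|ne] := eqVneq a (b + lattice_vec l); first by rewrite tpiD.
  set r := `|b + lattice_vec l - a|.
  have r0 : 0 < r / 2 by rewrite divr_gt0 // normr_gt0 subr_eq0 eq_sym.
  have qb' : tpi (b + lattice_vec l) = q by rewrite tpiD.
  have [v [m]] := cl _ _ _ _ pa qb' (nbhsx_ballx a _ r0) (nbhsx_ballx _ _ r0).
  rewrite -!ball_normE /ball_ /= => -[Hv Hw]; exfalso.
  have m0 : lattice_vec m = 0.
    apply: lattice_vec_lt1.
    have -> : lattice_vec m = (a - v) - (b + lattice_vec l - (v + lattice_vec m)) +
       (b + lattice_vec l - a).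
      by apply/rowP => j; rewrite !mxE; ring.
    apply: (le_lt_trans (ler_normD _ _)).
    apply: (@lt_le_trans _ _ (r / 2 + r / 2 + 2^-1)).
      apply: ltrD => //; apply: (le_lt_trans (ler_normB _ _)); exact: ltrD.
    by rewrite -splitr -[leRHS]half_half lerD2r ltW.
  have : r < r.
    have {1}-> : r = `|(a - v) - (b + lattice_vec l - (v + lattice_vec m))|.
      rewrite m0 addr0 /r distrC; congr `|_|.
      by apply/rowP => j; rewrite !mxE; ring.
    by apply: (le_lt_trans (ler_normB _ _)); rewrite [ltRHS]splitr ltrD.
  by rewrite ltxx.
(* Radius 1/4: if these balls met modulo the lattice, a translate of [b] would lie within 1/2 of
   [a]. *)
have r0 : 0 < (2^-1 / 2 : C) by rewrite divr_gt0 // complex_half_gt0.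
have [v [m]] := cl _ _ _ _ pa qb (nbhsx_ballx a _ r0) (nbhsx_ballx _ _ r0).
rewrite -!ball_normE /ball_ /= => -[Hv Hw]; exfalso; apply: Hn; exists (- m).
rewrite lattice_vecN.
have -> : b - lattice_vec m - a = (b - (v + lattice_vec m)) - (a - v).
  by apply/rowP => j; rewrite !mxE; ring.
by apply: (le_lt_trans (ler_normB _ _)); rewrite [ltRHS]splitr ltrD.
Qed.

(** The cube with sides the closed unit square is compact and meets every class: subtract the
    integer parts of the coordinates. *)
Lemma torus_compact : compact [set: mpt torus].
Proof.
pose A := (fun p : R * R => p.1 +i* p.2 : C) @` (`[0, 1] `*` `[0, 1]).
have cA : compact A.
  apply: continuous_compact.
    by apply: continuous_subspaceT; exact: complex_continuous.
  by apply: compact_setX; exact: segment_compact.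
have cB := @rV_compact _ n (fun=> A) (fun=> cA).
have := continuous_compact (continuous_subspaceT tpi_continuous) cB.
congr compact; apply/seteqP; split=> // p _.
pose z := rep p.
pose l : lattice := (\row_j (- Num.floor (complex.Re (z 0 j))),
  \row_j (- Num.floor (complex.Im (z 0 j)))).
exists (z + lattice_vec l); last by rewrite tpiD; exact: tpi_rep.
move=> j /=; exists (complex.Re (z 0 j) - (Num.floor (complex.Re (z 0 j)))%:~R,
  complex.Im (z 0 j) - (Num.floor (complex.Im (z 0 j)))%:~R).
  have H (t : R) : `[0, 1]%classic (t - (Num.floor t)%:~R).
    rewrite /= in_itv /= subr_ge0 floor_le /= lerBlDl ltW //.
    by have /andP[_] := floor_itv t; rewrite intrD.
  by split; exact: H.
by rewrite !mxE /= !intrN; case: (z 0 j).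
Qed.

(** The torus is a union of images of real lines, all passing through the class of 0. *)
Lemma torus_connected : connected [set: mpt torus].
Proof.
pose f (v : 'rV[C]_n) (t : R) : mpt torus := tpi (t%:C *: v).
have -> : [set: mpt torus] = \bigcup_(v in setT) (f v @` setT).
  apply/seteqP; split=> // p _; exists (rep p) => //; exists 1 => //.
  by rewrite /f scale1r; exact: tpi_rep.
apply: bigcup_connected.
  by exists (tpi 0) => v _; exists 0 => //; rewrite /f scale0r.
move=> v _; apply: connected_continuous_connected.
  by apply/connected_intervalP => x y _ _ z _.
apply: continuous_subspaceT => t.
apply: continuous_comp; last exact: tpi_continuous.
apply: (@continuous_comp _ _ _ (fun t : R => t%:C : C) (fun c => c *: v));
  last exact: scalel_continuous.
apply/cvgrPdist_lt => e /gt0_real [r r0 ->].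
have /cvgrPdist_lt/(_ _ r0) : (s @[s --> t] --> t) by exact: cvg_id.
apply: filterS => s ts.
apply: (@le_lt_trans _ _ (`|t - s| + `|0|)%:C); last by rewrite normr0 addr0 ltcR.
by apply: le_trans (normc_le_add _ _); rewrite -rmorphB.
Qed.

End Torus.

(** * Matrix representatives in PGL and in the stabilizer *)

Section ProjectiveLinearCharts.
Variables (C : numFieldType) (n : nat).
Local Notation M := 'M[C]_n.+1.
Local Notation G := (PGL_lie C n).
Local Notation idx2 := ('I_n.+1 * 'I_n.+1)%type.
Implicit Types (A B P : M) (s : idx2).

(** Total on matrices, so that it composes with [mu]; singular matrices are sent to the class of the
    identity. *)
Definition pcl A : PGL C n := PGL_cl (insubd (GL1 C n) A).

Lemma pclP A B : A \in unitmx -> B \in unitmx ->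
  pcl A = pcl B <-> exists2 c, c != 0 & B = c *: A.
Proof. by move=> uA uB; rewrite /pcl PGL_clP !insubdK. Qed.

Lemma rmx_unit (g : PGL C n) : rmx g \in unitmx.
Proof. exact: valP (rep g). Qed.

Lemma pcl_rmx (g : PGL C n) : pcl (rmx g) = g.
Proof. by rewrite /pcl /rmx valKd /PGL_cl repK. Qed.

Lemma rmx_pcl A : A \in unitmx -> exists2 c, c != 0 & A = c *: rmx (pcl A).
Proof. by move=> uA; apply/pclP; rewrite ?rmx_unit // pcl_rmx. Qed.

Lemma pclM A B : A \in unitmx -> B \in unitmx ->
  (pcl A * pcl B)%g = pcl (A *m B).
Proof.
move=> uA uB; rewrite [LHS]PGL_mulE /pcl; congr PGL_cl; apply: val_inj.
rewrite [RHS]insubdK; last by rewrite unfold_in unitmx_mul uA.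
by congr mulmx; exact: insubdK.
Qed.

Lemma pcl1 : pcl 1%:M = 1%g.
Proof. by rewrite /pcl; congr PGL_cl; apply: val_inj; rewrite insubdK //; exact: unitmx1. Qed.

Lemma pclV A : A \in unitmx -> (pcl A)^-1%g = pcl (invmx A).
Proof.
move=> uA; rewrite [LHS]PGL_invE /pcl; congr PGL_cl; apply: val_inj.
rewrite [RHS]insubdK; last by rewrite unfold_in unitmx_inv.
by congr invmx; exact: insubdK.
Qed.

(* In the affine chart of index [s], [kap s] gives the coordinates of the class of
   a matrix and [mu s y] the representative of the class with coordinates [y]
   whose entry [s] is 1; [lam s] is the linear part of [mu s] and [dkap s A] is the
   differential of [kap s] at [A]. *)
Definition aidx s := mxvec_index s.1 s.2.

Definition prj s B : 'rV[C]_(n.+1 * n.+1).-1 := col' (aidx s) (mxvec B).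

Definition kap s A := prj s ((A s.1 s.2)^-1 *: A).

Definition lam s (v : 'rV[C]_(n.+1 * n.+1).-1) : M :=
  vec_mx (\row_t (if unlift (aidx s) t is Some t' then v 0 t' else 0)).

Definition mu s (v : 'rV[C]_(n.+1 * n.+1).-1) : M :=
  vec_mx (\row_t (if unlift (aidx s) t is Some t' then v 0 t' else 1)).

Lemma prj_linear s : linear (prj s).
Proof. by move=> a A B; apply/rowP => t; rewrite /prj linearP !mxE. Qed.

Lemma lam_linear s : linear (lam s).
Proof.
move=> a u v; rewrite /lam -linearP; congr vec_mx; apply/rowP => t; rewrite !mxE.
by case: unlift => [t'|]; rewrite ?mxE // mulr0 addr0.
Qed.

Lemma mu_lam s v : mu s v = lam s v + delta_mx s.1 s.2.
Proof.
rewrite /lam /mu -[delta_mx _ _ in RHS]mxvecK -linearD; congr vec_mx.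
apply/rowP => t; rewrite mxvec_delta !mxE /aidx eqxx /=.
by case: unliftP => [t' ->|->]; rewrite ?eqxx ?add0r // eq_sym (negPf (neq_lift _ _)) addr0.
Qed.

Lemma lam_idx s v : lam s v s.1 s.2 = 0.
Proof. by rewrite /lam !mxE unlift_none. Qed.

Lemma mu_idx s v : mu s v s.1 s.2 = 1.
Proof. by rewrite mu_lam mxE lam_idx !mxE !eqxx add0r. Qed.

Lemma lamK s v : prj s (lam s v) = v.
Proof. by apply/rowP => t; rewrite /prj /lam vec_mxK !mxE liftK. Qed.

Lemma prjK s B : B s.1 s.2 = 0 -> lam s (prj s B) = B.
Proof.
move=> B0; rewrite -[RHS]mxvecK; congr vec_mx; apply/rowP => t; rewrite !mxE.
by case: unliftP => [t' ->|->]; rewrite ?mxE // -/(aidx s) mxvecE.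
Qed.

Lemma prj_delta s : prj s (delta_mx s.1 s.2) = 0.
Proof.
apply/rowP => t; rewrite /prj mxvec_delta !mxE eqxx /= /aidx.
by rewrite eq_sym (negPf (neq_lift _ _)).
Qed.

Lemma mu_prj s A : A s.1 s.2 = 1 -> mu s (prj s A) = A.
Proof.
move=> A1; rewrite mu_lam -[A in LHS](subrK (delta_mx s.1 s.2)) -[_ - _ + _]scale1r.
rewrite -[1 *: _]/(1 *: _) scalerDr !scale1r.
have -> : prj s (A - delta_mx s.1 s.2 + delta_mx s.1 s.2) = prj s (A - delta_mx s.1 s.2).
  by rewrite -[A - _ in LHS]scale1r prj_linear scale1r prj_delta addr0.
by rewrite prjK ?subrK // !mxE !eqxx A1 subrr.
Qed.

Lemma mu_kap s A : A s.1 s.2 != 0 -> mu s (kap s A) = (A s.1 s.2)^-1 *: A.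
Proof. by move=> A0; rewrite mu_prj // mxE mulVf. Qed.

Lemma kapZ s c A : c != 0 -> kap s (c *: A) = kap s A.
Proof.
move=> c0; rewrite /kap mxE invfM scalerA mulrAC mulVf // mul1r //.
Qed.

Definition dkap s A B :=
  prj s ((A s.1 s.2)^-1 *: B - ((A s.1 s.2) ^- 2 * B s.1 s.2) *: A).

(** By the quotient rule, the normalised entry is constantly 1 and its derivative is 0, so [prj]
    loses nothing here. *)
Lemma lam_dkap s A B : A s.1 s.2 != 0 -> lam s (dkap s A B) =
  (A s.1 s.2)^-1 *: B - ((A s.1 s.2) ^- 2 * B s.1 s.2) *: A.
Proof.
by move=> A0; rewrite prjK // !mxE; field.
Qed.

Lemma mu_is_diff s y : is_diff y (mu s) (lam s).
Proof.
have -> : mu s = lam s + cst (delta_mx s.1 s.2).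
  by apply/funext => v; rewrite mu_lam.
rewrite -[X in is_diff _ _ X]addr0; apply: is_diffD.
exact/is_diff_linear/lam_linear.
Qed.

Lemma kap_is_diff (V : normedModType C) s (F dF : V -> M) x :
  F x s.1 s.2 != 0 -> is_diff x F dF ->
  is_diff x (fun y => kap s (F y)) (fun v => dkap s (F x) (dF v)).
Proof.
move=> F0 dFx.
have d1 := is_diff_inv F0 (is_diff_comp_coord s.1 s.2 dFx).
have d2 := is_diff_scalemx d1 dFx.
have d3 := is_diff_linear ((F x s.1 s.2)^-1 *: F x) (@prj_linear s).
have d4 := is_diff_comp d2 d3.
suff -> : (fun v => dkap s (F x) (dF v)) = prj s \o
  (fun v => - (F x s.1 s.2) ^- 2 * dF v s.1 s.2 *: F x + (F x s.1 s.2)^-1 *: dF v).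
  exact: d4.
by apply/funext => v; rewrite /dkap /= mulNr scaleNr addrC.
Qed.

Lemma PGL_cmapE s A : A \in unitmx ->
  cmap (PGL_affine C s.1 s.2) (pcl A) = kap s A.
Proof.
by move=> /rmx_pcl [c c0 E]; rewrite [in RHS]E kapZ.
Qed.

Definition pidx (g : PGL C n) : idx2 :=
  odflt (0, 0) [pick s : idx2 | rmx g s.1 s.2 != 0].

Lemma pidxP g : rmx g (pidx g).1 (pidx g).2 != 0.
Proof.
rewrite /pidx; case: pickP => [s ->//|H].
have := rmx_unit g; suff -> : rmx g = 0 by rewrite unitmxE det0 unitr0.
by apply/matrixP => i j; apply/eqP; have := H (i, j); rewrite mxE => /negbFE.
Qed.

Lemma PGL_chartE (g : lgm G) : chart_at g = PGL_affine C (pidx g).1 (pidx g).2.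
Proof. by []. Qed.

(* The index of the chart at 1, hence of the coordinates of the Lie algebra. *)
Definition s1 := pidx (1%g : PGL C n).

(** Every representative of 1 is a scalar matrix, whose nonzero entries are all diagonal. *)
Lemma s1_diag : s1.1 = s1.2.
Proof.
have [c c0 E] := rmx_pcl (unitmx1 C n.+1); have := pidxP 1%g.
rewrite -/s1 -pcl1 => H; apply/eqP; apply: contraNT H => ne.
have : (1%:M : M) s1.1 s1.2 = 0 by rewrite mxE (negPf ne).
by rewrite {1}E mxE => /eqP; rewrite mulf_eq0 (negPf c0).
Qed.

Lemma one_s1 : (1%:M : M) s1.1 s1.2 = 1.
Proof. by rewrite mxE s1_diag eqxx. Qed.

(* The projection gl -> pgl = T_1 G, in the chart at 1. *)
Definition pgl B := prj s1 (B - (B s1.1 s1.2)%:M).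

Lemma pgl_linear : linear pgl.
Proof.
move=> a A B; rewrite /pgl -prj_linear; congr prj.
by rewrite !mxE scalerBr scale_scalar_mx rmorphD /= opprD addrACA.
Qed.

Lemma lam_pgl B : lam s1 (pgl B) = B - (B s1.1 s1.2)%:M.
Proof. by rewrite prjK // !mxE s1_diag eqxx subrr. Qed.

Lemma pgl_lam v : pgl (lam s1 v) = v.
Proof. by rewrite /pgl lam_idx raddf0 subr0 lamK. Qed.

Lemma pgl_scalar a : pgl a%:M = 0.
Proof. 
rewrite /pgl mxE s1_diag eqxx mulr1n subrr.
by apply/rowP => t; rewrite /prj linear0 !mxE.
Qed.

Lemma pglP A B : pgl A = pgl B <-> exists a, A = B + a%:M.
Proof.
split=> [E|[a ->]]; last first.
  by have := pgl_linear 1 B a%:M; rewrite !scale1r pgl_scalar addr0.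
have := congr1 (lam s1) E; rewrite !lam_pgl => /eqP; rewrite subr_eq => /eqP E'.
exists (A s1.1 s1.2 - B s1.1 s1.2).
by rewrite {1}E' rmorphB /= -addrA [X in _ + X]addrC.
Qed.

Lemma pglDscalar A a : pgl (A + a%:M) = pgl A.
Proof. by apply/pglP; exists a. Qed.

(** [lam s1 (pgl B)] differs from [B] by a scalar matrix, and conjugation fixes scalar matrices. *)
Lemma pgl_conj_lam A B : A \in unitmx ->
  pgl (invmx A *m lam s1 (pgl B) *m A) = pgl (invmx A *m B *m A).
Proof.
move=> uA; rewrite lam_pgl mulmxBr mulmxBl -!mulmxA -scalar_mxC mulKmx //.
by rewrite -raddfN pglDscalar.
Qed.

Lemma dkap1 B : dkap s1 1%:M B = pgl B.
Proof. by rewrite /dkap one_s1 expr1n invr1 scale1r mul1r scalemx1. Qed.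

(* The Maurer-Cartan form does not depend on the chart. *)
Lemma mc_dkap s P B : P \in unitmx -> P s.1 s.2 != 0 ->
  pgl (invmx (mu s (kap s P)) *m lam s (dkap s P B)) = pgl (invmx P *m B).
Proof.
move=> uP P0; rewrite mu_kap // lam_dkap // invmxZ ?unitmxZ ?unitfE ?invr_eq0 //.
rewrite invrK -scalemxAl mulmxBr scalerBr -!scalemxAr !scalerA mulfV // scale1r.
by rewrite mulVmx // scalemx1 -raddfN pglDscalar.
Qed.

Lemma mu_kap_unit s P : P \in unitmx -> P s.1 s.2 != 0 ->
  mu s (kap s P) \in unitmx.
Proof. by move=> uP P0; rewrite mu_kap // unitmxZ // unitfE invr_eq0. Qed.

Lemma mu_unit_near s P : P \in unitmx -> P s.1 s.2 != 0 ->
  \forall y \near kap s P, mu s y \in unitmx.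
Proof.
move=> uP P0; have [d _] := mu_is_diff s (kap s P).
exact: (differentiable_continuous d (unitmx_near (mu_kap_unit uP P0))).
Qed.

Lemma PGL_cmap1 : cmap (chart_at (1%g : lgm G)) 1%g = kap s1 1%:M.
Proof. by rewrite -{2}pcl1 PGL_chartE PGL_cmapE // unitmx1. Qed.

Lemma mu1 : mu s1 (kap s1 1%:M) = 1%:M.
Proof. by rewrite mu_kap ?one_s1 ?oner_neq0 // invr1 scale1r. Qed.

Lemma PGL_AdE A u : A \in unitmx ->
  Ad (pcl A : G) u = pgl (A *m lam s1 u *m invmx A).
Proof.
move=> uA; rewrite /Ad /mderiv PGL_cmap1.
have uV : invmx A \in unitmx by rewrite unitmx_inv.
have one : (pcl A * 1 * (pcl A)^-1)%g = 1%g by rewrite mulg1 mulgV.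
have d1 := mu_is_diff s1 (kap s1 1%:M).
have d2 := is_diff_mulmx (is_diff_mulmx (is_diff_const A (kap s1 1%:M)) d1)
  (is_diff_const (invmx A) (kap s1 1%:M)).
have [_ E] : is_diff (kap s1 1%:M)
   (wr (M := lgm G) (N := lgm G) (fun x : G => (pcl A : G) * x * (pcl A : G)^-1)%g 1%g)
   (fun v => dkap s1 1%:M (A *m lam s1 v *m invmx A)).
  have F1 : A *m mu s1 (kap s1 1%:M) *m invmx A = 1%:M.
    by rewrite mu1 mulmx1 mulmxV.
  have := kap_is_diff (s := s1) _ d2; rewrite /= F1 one_s1 oner_neq0 => /(_ isT) d3.
  apply: (@is_diff_near _ _ _ (fun y => kap s1 (A *m mu s1 y *m invmx A))).
    apply: filterS (mu_unit_near (unitmx1 C n.+1) _); last by rewrite one_s1 oner_neq0.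
    move=> y uy; rewrite /wr one /= -/(pcl _).
    by rewrite pclV // !pclM ?unitmx_mul ?uA // -PGL_cmapE // !unitmx_mul uA uy.
  apply: (is_diff_ext d3) => v /=.
  by rewrite mulmx0 addr0 mul0mx add0r.
by rewrite E dkap1.
Qed.

End ProjectiveLinearCharts.

(** * The Lie bracket of pgl as a commutator of matrices *)

Section LieBracket.
Variables (C : numFieldType) (n : nat).
Local Notation M := 'M[C]_n.+1.
Local Notation G := (PGL_lie C n).

Local Notation s := (s1 C n).

Lemma left_fieldE (u y : 'rV[C]_(n.+1 * n.+1).-1) :
  mu (s1 C n) y \in unitmx -> @left_field C _ G u y =
  prj (s1 C n) (mu (s1 C n) y *m lam (s1 C n) u -
    (mu (s1 C n) y *m lam (s1 C n) u) (s1 C n).1 (s1 C n).2 *: mu (s1 C n) y).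
Proof.
move=> uy; rewrite /left_field PGL_cmap1.
have [_ E] : is_diff (kap s 1%:M)
    (fun t => cmap (chart_at (1%g : lgm G))
       (cinv (chart_at (1%g : lgm G)) y * cinv (chart_at (1%g : lgm G)) t)%g)
    (fun v => dkap s (mu s y) (mu s y *m lam s v)).
  have F1 : mu s y *m mu s (kap s 1%:M) = mu s y by rewrite mu1 mulmx1.
  have d2 := is_diff_mulmx (is_diff_const (mu s y) (kap s 1%:M))
    (mu_is_diff s (kap s 1%:M)).
  have := kap_is_diff (s := s) _ d2; rewrite /= F1 mu_idx oner_neq0 => /(_ isT) d3.
  apply: (@is_diff_near _ _ _ (fun t => kap s (mu s y *m mu s t))).
    apply: filterS (mu_unit_near (unitmx1 C n.+1) _); last by rewrite one_s1 oner_neq0.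
    move=> t ut.
    transitivity (cmap (chart_at (1%g : lgm G)) (pcl (mu s y) * pcl (mu s t))%g) => //.
    by rewrite pclM // PGL_chartE PGL_cmapE // unitmx_mul uy.
  apply: (is_diff_ext d3) => v /=.
  by rewrite mul0mx add0r.
by rewrite E /dkap mu_idx expr1n invr1 scale1r mul1r.
Qed.

(** The left-invariant field of [w] is N |-> N w, corrected by a multiple of N that keeps the
    normalised entry fixed. At the identity the derivative of the correction is a scalar matrix,
    since [lam] has zero entry at [s1]. *)
Lemma lie_bracketE (u v : 'rV[C]_(n.+1 * n.+1).-1) :
  lie_bracket G u v = pgl (lam (s1 C n) u *m lam (s1 C n) v -
                           lam (s1 C n) v *m lam (s1 C n) u).
Proof.
rewrite /lie_bracket PGL_cmap1; set o := kap s 1%:M.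
have H (w : 'rV[C]_(n.+1 * n.+1).-1) : is_diff o (@left_field C _ G w)
    (fun t => pgl (lam s t *m lam s w)).
  have d1 := is_diff_mulmx (mu_is_diff s o) (is_diff_const (lam s w) o).
  have d2 := is_diff_scalemx (is_diff_comp_coord s.1 s.2 d1) (mu_is_diff s o).
  have d3 := is_diff_sub d1 d2.
  have d4 := is_diff_comp d3 (is_diff_linear _ (@prj_linear C n s)).
  apply: (@is_diff_near _ _ _ (fun y => prj s (mu s y *m lam s w -
    (mu s y *m lam s w) s.1 s.2 *: mu s y))).
    apply: filterS (mu_unit_near (unitmx1 C n.+1) _); last by rewrite one_s1 oner_neq0.
    by move=> y uy; rewrite left_fieldE.
  apply: (is_diff_ext d4) => t /=.
  rewrite /pgl; apply: (congr1 (prj s)); rewrite mulmx0 addr0 /o mu1 mul1mx lam_idx scale0r addr0.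
  by rewrite scalemx1.
have E a b : 'd (@left_field C _ G a) o b = pgl (lam s b *m lam s a).
  exact: (congr1 (fun g : 'rV[C]_(n.+1 * n.+1).-1 -> 'rV[C]_(n.+1 * n.+1).-1 => g b)
    (@diff_val _ _ _ _ _ _ _ (H a))).
apply: (etrans (congr2 (fun a b : 'rV[C]_(n.+1 * n.+1).-1 => a - b) (E v u) (E u v))).
have := pgl_linear (-1) (lam s v *m lam s u) (lam s u *m lam s v).
by rewrite !scaleN1r addrC => <-; rewrite addrC.
Qed.
End LieBracket.

(** * The stabilizer of a point and its Lie algebra *)

Section Stabilizer.
Variables (C : numFieldType) (n : nat).
Local Notation M := 'M[C]_(1 + n).
Local Notation G := (PGL_lie C n).
Local Notation H := (stab_lie C n).
Implicit Types (A B P : M) (h k : stab C n) (v y : 'rV[C]_(n + n * n)).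

(* [A] fixes the line of the base point. *)
Definition parab A := dlsubmx A = 0.

Lemma parabM A B : parab A -> parab B -> parab (A *m B).
Proof.
rewrite /parab => pA pB; rewrite -[A]submxK -[B]submxK mulmx_block block_mxKdl.
by rewrite pA pB mul0mx mulmx0 addr0.
Qed.

Lemma parab1 : parab 1%:M.
Proof. by rewrite /parab scalar_mx_block block_mxKdl. Qed.

Lemma parabZ a A : parab A -> parab (a *: A).
Proof.
rewrite /parab => pA; apply/matrixP => i j; have /matrixP/(_ i j) := pA.
by rewrite !mxE => ->; rewrite mulr0.
Qed.

Lemma parabB A B : parab A -> parab B -> parab (A - B).
Proof. 
move=> pA pB; apply/matrixP => i j; have /matrixP/(_ i j) := pB; have /matrixP/(_ i j) := pA.
by rewrite !mxE => -> ->; rewrite subr0.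
Qed.

Lemma parabP A : parab A <-> A *m delta_mx 0 0 = A 0 0 *: (delta_mx 0 0 : 'cV[C]_(1 + n)).
Proof.
split=> [/matrixP pA|/matrixP pA].
  apply/matrixP => i j; rewrite mxE (bigD1 0) //= big1 ?addr0 => [|k k0]; last first.
    by rewrite mxE (negPf k0) mulr0.
  rewrite !mxE ord1 eqxx andbT mulr1.
  have [->|i0] := eqVneq i 0; first by rewrite mulr1.
  rewrite mulr0; case: (split_ordP i) i0 => [i' ->|i' ->].
    by rewrite ord1 (_ : lshift n 0 = 0) ?eqxx //; apply/val_inj.
  move=> _; have := pA i' 0; rewrite !mxE => <-; congr (A _ _); exact/val_inj.
apply/matrixP => i j; have := pA (rshift 1 i) 0; rewrite !mxE (bigD1 0) //=.
rewrite big1 ?addr0 => [|k k0]; last by rewrite mxE (negPf k0) mulr0.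
by rewrite !mxE eqxx mulr1 mulr0 => <-; congr (A _ _); apply/val_inj; rewrite ord1.
Qed.

(** The (0, 0) entry is a character on matrices fixing the base line, hence normalising by it is
    compatible with products. *)
Lemma parab_idx A B : parab B -> (A *m B) 0 0 = A 0 0 * B 0 0.
Proof.
move=> /parabP /matrixP/(_ _ 0) H; rewrite mxE (bigD1 0) //= big1 ?addr0 // => k k0.
have := H k; rewrite mxE (bigD1 0) //= big1 ?addr0 => [|l l0]; last first.
  by rewrite mxE (negPf l0) mulr0.
by rewrite !mxE eqxx mulr1 (negPf k0) mulr0 => ->; rewrite mulr0.
Qed.

Lemma parab_unit A : parab A -> A \in unitmx -> A 0 0 != 0.
Proof.
move=> /parabP pA uA; apply: contraTneq uA => A0; rewrite A0 scale0r in pA.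
apply/negP => uA; have := mulKmx uA (delta_mx 0 0 : 'cV[C]_(1 + n)).
rewrite pA mulmx0 => /matrixP/(_ 0 0); rewrite !mxE eqxx /= => /esym/eqP.
by rewrite oner_eq0.
Qed.

Lemma stab_baseP A : A \in unitmx -> stab_base (pcl A) = `[< parab A >].
Proof.
move=> uA; have vE : val (GL_app (insubd (GL1 C n) A) (tonzvec (base_vec_subproof C n))) =
    A *m (delta_mx 0 0 : 'cV[C]_(1 + n)).
  by congr mulmx; exact: insubdK.
rewrite /stab_base; apply: asbool_equiv_eq.
rewrite /pcl /base_point PGL_appE; split.
  move=> /esym/proj_clP [c c0]; rewrite vE => E; apply/parabP.
  have {}E : A *m (delta_mx 0 0 : 'cV[C]_(1 + n)) = c *: delta_mx 0 0 by [].
  rewrite E; congr (_ *: _); have := congr1 (fun B : 'cV[C]_(1 + n) => B 0 0) E.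
  rewrite mxE (bigD1 0) //= big1 ?addr0 => [|k k0]; last by rewrite mxE (negPf k0) mulr0.
  by rewrite !mxE !eqxx !mulr1.
move=> pA; apply/esym/proj_clP; exists (A 0 0); first exact: parab_unit.
by rewrite vE; apply/parabP.
Qed.

Definition scl A : stab C n := insubd (1%g : stab C n) (pcl A).

Lemma val_scl A : A \in unitmx -> parab A -> val (scl A) = pcl A.
Proof.
move=> uA pA; have : stab_base (pcl A) by rewrite stab_baseP //; apply/asboolP.
exact: insubdK.
Qed.

(* The representative with entry (0, 0) equal to 1; it is multiplicative in [h]. *)
Definition hmx h : M := (rmx (val h) 0 0)^-1 *: (rmx (val h) : M).

Lemma rmx_parab h : parab (rmx (val h)).
Proof.
have := valP h; rewrite -[val h in X in X -> _]pcl_rmx stab_baseP ?rmx_unit //.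
by move/asboolP.
Qed.

Lemma rmx_h0 h : rmx (val h) 0 0 != 0.
Proof. exact: parab_unit (rmx_parab h) (rmx_unit _). Qed.

Lemma hmx_parab h : parab (hmx h).
Proof. exact/parabZ/rmx_parab. Qed.

Lemma hmx_unit h : hmx h \in unitmx.
Proof. by rewrite unitmxZ ?rmx_unit // unitfE invr_eq0 rmx_h0. Qed.

Lemma hmx00 h : hmx h 0 0 = 1.
Proof. by rewrite mxE mulVf ?rmx_h0. Qed.

Lemma pcl_hmx h : pcl (hmx h) = val h.
Proof.
apply/esym; rewrite -[LHS]pcl_rmx; apply/pclP; rewrite ?rmx_unit ?hmx_unit //.
by exists (rmx (val h) 0 0)^-1; rewrite ?invr_eq0 ?rmx_h0.
Qed.

Lemma scl_hmx h : scl (hmx h) = h.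
Proof. by apply/val_inj; rewrite val_scl ?hmx_unit ?pcl_hmx //; exact: hmx_parab. Qed.

(** Two lifts of one class differ by a scalar, which the (0, 0) entry determines. *)
Lemma hmx_eq A h : A \in unitmx -> A 0 0 = 1 -> pcl A = val h -> hmx h = A.
Proof.
move=> uA A1; rewrite -pcl_hmx => /pclP [||c _ E]; rewrite ?hmx_unit //.
by have := hmx00 h; rewrite E mxE A1 mulr1 => ->; rewrite scale1r.
Qed.

Lemma hmx_scl A : A \in unitmx -> parab A -> A 0 0 = 1 -> hmx (scl A) = A.
Proof. by move=> uA pA A1; apply: hmx_eq => //; rewrite val_scl. Qed.

Lemma hmxM h k : hmx (h * k)%g = hmx h *m hmx k.
Proof.
apply: hmx_eq; first by rewrite unitmx_mul !hmx_unit.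
  by rewrite parab_idx ?hmx00 ?mulr1 //; exact: hmx_parab.
by rewrite -pclM ?hmx_unit // !pcl_hmx.
Qed.

Lemma hmx1 : hmx 1%g = 1%:M.
Proof. by apply: hmx_eq; rewrite ?unitmx1 ?mxE // pcl1. Qed.

Lemma hmxV h : hmx h^-1%g = invmx (hmx h).
Proof.
have := hmxM h h^-1%g; rewrite mulgV hmx1 => /(congr1 (mulmx (invmx (hmx h)))).
by rewrite mulmx1 mulKmx ?hmx_unit.
Qed.

(* [nu] inverts the global chart [hprj \o hmx] of the stabilizer, and [nlam] is its
   linear part. *)
Definition nu y : M := block_mx 1 (lsubmx y) 0 (vec_mx (rsubmx y)).
Definition nlam v : M := block_mx 0 (lsubmx v) 0 (vec_mx (rsubmx v)).
Definition hprj B : 'rV[C]_(n + n * n) := row_mx (ursubmx B) (mxvec (drsubmx B)).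

Lemma hprj_linear : linear hprj.
Proof.
move=> a A B; rewrite /hprj scale_row_mx add_row_mx -!linearP; congr row_mx.
Qed.

Lemma nlam_linear : linear nlam.
Proof.
move=> a u v; rewrite /nlam scale_block_mx add_block_mx !linearP.
by rewrite !scaler0 !addr0.
Qed.

Lemma nu_nlam v : nu v = nlam v + block_mx 1 0 0 0.
Proof. by rewrite /nu /nlam add_block_mx !addr0 add0r. Qed.

Lemma nu_is_diff y : is_diff y nu nlam.
Proof.
have -> : nu = nlam + cst (block_mx 1 0 0 0).
  by apply/funext => v; rewrite nu_nlam.
rewrite -[X in is_diff _ _ X]addr0; apply: is_diffD.
exact/is_diff_linear/nlam_linear.
Qed.

Lemma ord0_lshift : 0 = lshift n (0 : 'I_1) :> 'I_(1 + n).
Proof. exact/val_inj. Qed.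

Lemma nu_parab y : parab (nu y).
Proof. by rewrite /parab block_mxKdl. Qed.

Lemma nlam_parab v : parab (nlam v).
Proof. by rewrite /parab block_mxKdl. Qed.

Lemma nu00 y : nu y 0 0 = 1.
Proof. by rewrite /nu ord0_lshift block_mxEul mxE. Qed.

Lemma nlam00 v : nlam v 0 0 = 0.
Proof. by rewrite /nlam ord0_lshift block_mxEul mxE. Qed.

Lemma hprj_nlam v : hprj (nlam v) = v.
Proof. by rewrite /hprj block_mxKur block_mxKdr vec_mxK hsubmxK. Qed.

Lemma hprj_nu v : hprj (nu v) = v.
Proof. by rewrite /hprj block_mxKur block_mxKdr vec_mxK hsubmxK. Qed.

Lemma nlam_hprj B : parab B -> B 0 0 = 0 -> nlam (hprj B) = B.
Proof.
move=> pB B0; rewrite /nlam row_mxKl row_mxKr mxvecK -[RHS]submxK pB; congr block_mx.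
by apply/matrixP => i j; rewrite !mxE !ord1 -ord0_lshift B0.
Qed.

Lemma nu_hprj B : parab B -> B 0 0 = 1 -> nu (hprj B) = B.
Proof.
move=> pB B0; rewrite /nu row_mxKl row_mxKr mxvecK -[RHS]submxK pB; congr block_mx.
by apply/matrixP => i j; rewrite !mxE !ord1 -ord0_lshift B0.
Qed.

Lemma stab_cmapE (g h : lgm H) : cmap (chart_at g) h = hprj (hmx h).
Proof. by []. Qed.

Lemma stab_cinvE (g : lgm H) y : cinv (chart_at g) y = scl (nu y).
Proof. by []. Qed.

Lemma nu_unit_near h : \forall y \near hprj (hmx h), nu y \in unitmx.
Proof.
have [d _] := nu_is_diff (hprj (hmx h)).
have U : nu (hprj (hmx h)) \in unitmx.
  by rewrite nu_hprj ?hmx00 ?hmx_unit //; exact: hmx_parab.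
exact: (differentiable_continuous d (unitmx_near U)).
Qed.

Lemma hmx_scl_nu y : nu y \in unitmx -> hmx (scl (nu y)) = nu y.
Proof. by move=> uy; rewrite hmx_scl ?nu00 //; exact: nu_parab. Qed.

(** All the charts are one and the same global chart, so the translation is by 0; its image is the
    open set where [nu] is invertible. *)
Lemma stab_flat : flat_atlas (lgm H).
Proof.
split; first split=> //.
  move=> x p _; rewrite stab_cmapE stab_cinvE nu_hprj ?scl_hmx ?hmx00 //.
  exact: hmx_parab.
move=> x y p _ _; exists 0; apply: filterS (nu_unit_near p) => t ut.
by split=> //; rewrite stab_cmapE stab_cinvE hmx_scl_nu // hprj_nu ?addr0.
Qed.

(** The global chart is a continuous injection into a normed space. *)
Lemma stab_hausdorff : hausdorff_space (mpt (lgm H)).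
Proof.
move=> h g cl; rewrite -(scl_hmx h) -(scl_hmx g); congr scl.
have [[dM cM] _] := stab_flat.
suff E : hprj (hmx h) = hprj (hmx g).
  have := congr1 nu E; rewrite !nu_hprj ?hmx00 //; exact: hmx_parab.
apply: (@norm_hausdorff _ 'rV[C]_(n + n * n)) => A B nA nB.
have pre (p : lgm H) (D : set 'rV[C]_(n + n * n)) : nbhs (hprj (hmx p)) D ->
    nbhs (p : mpt (lgm H)) [set q : lgm H | D (hprj (hmx q))].
  move=> nD; apply/(flat_nbhsP _ stab_flat (dM p)).
  apply: filterS2 nD (nu_unit_near p) => t Dt ut.
  suff : D (hprj (hmx (scl (nu t)))) by [].
  by rewrite hmx_scl_nu // hprj_nu.
by have [q [Aq Bq]] := cl _ _ (pre h A nA) (pre g B nB); exists (hprj (hmx q)).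
Qed.

Lemma stab_lie_inE v : @lie_in C _ _ H G (@stab_in C n) v = pgl (nlam v).
Proof.
rewrite /lie_in /mderiv stab_cmapE.
have F1 : nu (hprj (hmx 1%g)) = 1%:M by rewrite nu_hprj ?hmx00 ?hmx1 //; exact: parab1.
have d3 := @kap_is_diff _ _ _ (s1 C n) _ _ (hprj (hmx 1%g)) _ (nu_is_diff _).
rewrite F1 one_s1 in d3; have {}d3 := d3 (oner_neq0 _).
have [_ E] : is_diff (hprj (hmx 1%g)) (wr (M := lgm H) (N := lgm G) (@stab_in C n) 1%g)
    (fun v => dkap (s1 C n) 1%:M (nlam v)).
  apply: is_diff_near d3; apply: filterS (nu_unit_near 1%g) => y uy.
  rewrite /wr /= -[LHS]PGL_cmapE // /stab_in -/(scl _) val_scl //; exact: nu_parab.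
by rewrite E dkap1.
Qed.

Lemma stab_AdE h v : Ad (h : H) v = hprj (hmx h *m nlam v *m invmx (hmx h)).
Proof.
rewrite /Ad /mderiv stab_cmapE; set o := hprj _.
have d1 := is_diff_mulmx (is_diff_mulmx (is_diff_const (hmx h) o) (nu_is_diff o))
  (is_diff_const (invmx (hmx h)) o).
have d2 := is_diff_comp d1 (is_diff_linear _ hprj_linear).
have [_ E] : is_diff o (wr (M := lgm H) (N := lgm H) (fun x : H => (h : H) * x * (h : H)^-1)%g 1%g)
   (fun v => hprj (hmx h *m nlam v *m invmx (hmx h))).
  apply: (@is_diff_near _ _ _ (fun y => hprj (hmx h *m nu y *m invmx (hmx h)))).
    apply: filterS (nu_unit_near 1%g) => y uy.
    transitivity (hprj (hmx (h * scl (nu y) * h^-1)%g)) => //.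
    by rewrite !hmxM hmxV hmx_scl_nu.
  apply: (is_diff_ext d2) => w /=.
  by rewrite mul0mx add0r mulmx0 addr0.
by rewrite E.
Qed.

Lemma nlam_stab_Ad h v : nlam (Ad (h : H) v) =
  hmx h *m nlam v *m invmx (hmx h).
Proof.
have p1 : parab (invmx (hmx h)) by rewrite -hmxV; exact: hmx_parab.
rewrite stab_AdE nlam_hprj //.
  by apply: parabM => //; apply: parabM; [exact: hmx_parab|exact: nlam_parab].
by rewrite !parab_idx ?nlam00 ?mulr0 ?mul0r //; exact: nlam_parab.
Qed.

(** Equivariance of the inclusion of h in g; it frees [iota1] from the choice of representative. *)
Lemma lie_in_Ad h v : @lie_in C _ _ H G (@stab_in C n) (Ad (h : H) v) =
  Ad (stab_in (h : H)) (@lie_in C _ _ H G (@stab_in C n) v).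
Proof.
rewrite !stab_lie_inE nlam_stab_Ad /stab_in -pcl_hmx PGL_AdE ?hmx_unit //.
have := pgl_conj_lam (nlam v) (A := invmx (hmx h)); rewrite invmxK => -> //.
by rewrite unitmx_inv hmx_unit.
Qed.

End Stabilizer.

(** * Classes of a group action and their chosen representatives *)

Section Actions.
Variables (T : Type) (A : groupType) (act : T -> A -> T).
Hypothesis act1 : forall t, act t 1%g = t.

Lemma cl_eq_act t u : cl act t = cl act u -> exists h, u = act t h.
Proof.
move=> tu; have E := cl_inj tu; have : range (act u) u by exists 1%g.
by rewrite -E => -[h _ <-]; exists h.
Qed.

(** Maps defined through [rep] are evaluated by this: the chosen representative is a translate, and
    equivariance absorbs the group element. *)
Lemma rep_cl t : exists h, rep (cl act t) = act t h.
Proof. by apply: cl_eq_act; rewrite repK. Qed.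

Hypothesis actM : forall t h k, act t (h * k)%g = act (act t h) k.

Lemma cl_act t h : cl act (act t h) = cl act t.
Proof.
apply: cl_eq; apply/seteqP; split=> _ [k _ <-].
  by exists (h * k)%g => //; rewrite actM.
by exists (h^-1 * k)%g => //; rewrite -actM mulgA mulgV mul1g.
Qed.
End Actions.

(** * Differentials in charts and of row vectors *)

Section Derivatives.
Variable C : numFieldType.

Lemma mderiv_val m n (M : manifold C m) (N : manifold C n) (f : M -> N) x df :
  is_diff (cmap (chart_at x) x) (wr f x) df -> forall v, mderiv f x v = df v.
Proof.
move=> H v; exact: (congr1 (fun g : 'rV[C]_m -> 'rV[C]_n => g v) (@diff_val _ _ _ _ _ _ _ H)).
Qed.

Lemma is_diff_row_mx (V : normedModType C) m n (f df : V -> 'rV[C]_m)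
  (g dg : V -> 'rV[C]_n) x : is_diff x f df -> is_diff x g dg ->
  is_diff x (fun y => row_mx (f y) (g y)) (fun v => row_mx (df v) (dg v)).
Proof.
move=> fx gx; apply: is_diff_mx => i j; case: (split_ordP j) => j' ->.
  have -> : (fun y => row_mx (f y) (g y) i (lshift n j') : C) = (fun y => f y i j').
    by apply/funext => y; rewrite row_mxEl.
  have -> : (fun y => row_mx (df y) (dg y) i (lshift n j') : C) = (fun y => df y i j').
    by apply/funext => y; rewrite row_mxEl.
  exact: is_diff_comp_coord.
have -> : (fun y => row_mx (f y) (g y) i (rshift m j') : C) = (fun y => g y i j').
  by apply/funext => y; rewrite row_mxEr.
have -> : (fun y => row_mx (df y) (dg y) i (rshift m j') : C) = (fun y => dg y i j').
  by apply/funext => y; rewrite row_mxEr.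
exact: is_diff_comp_coord.
Qed.

Lemma is_diff_lsub m n (y : 'rV[C]_(m + n)) : is_diff y (@lsubmx C 1 m n) lsubmx.
Proof. exact/is_diff_linear/linearP. Qed.

Lemma is_diff_rsub m n (y : 'rV[C]_(m + n)) : is_diff y (@rsubmx C 1 m n) rsubmx.
Proof. exact/is_diff_linear/linearP. Qed.

Lemma is_diff_then (V U W : normedModType C) (f df : V -> U) (g dg : U -> W) x :
  is_diff (f x) g dg -> is_diff x f df ->
  is_diff x (fun y => g (f y)) (fun v => dg (df v)).
Proof. by move=> dgx dfx; exact: (is_diff_comp dfx dgx). Qed.

Lemma flat_transition_is_diff n (M : manifold C n) (x p : M) : flat_atlas M ->
  cdom (chart_at x) p -> is_diff (cmap (chart_at x) p)
    (cmap (chart_at p) \o cinv (chart_at x)) id.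
Proof.
move=> [[dM cM] fM] dp; have [a Ha] := fM x p p dp (dM p).
by apply: (@is_diff_translation _ _ _ a); apply: filterS Ha => t [].
Qed.

End Derivatives.

(** * The trivial principal H-bundle *)

Section TrivialBundle.
Variables (C : numFieldType) (n : nat) (X : manifold C n).
Hypothesis flX : flat_atlas X.
Local Notation M := 'M[C]_n.+1.
Local Notation G := (PGL_lie C n).
Local Notation H := (stab_lie C n).
Local Notation i := (@stab_in C n).
Local Notation k := (n.+1 * n.+1).-1.
Local Notation m := (n + n * n)%N.

Definition trivial_bundle : pbundle X H :=
  @PBundle C n m X H (prodm X (lgm H)) (fun e => e.1)
    (fun e h => (e.1, e.2 * h)%g) (fun=> setT) (fun _ y => (y, 1%g)) (fun _ e => e.2).

Local Notation tb := trivial_bundle.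
Local Notation Ext := (@ext C n m k X H G i tb).

Let dX : forall x : X, cdom (chart_at x) x := flX.1.1.
Let cX : forall x p : X, cdom (chart_at x) p ->
  cinv (chart_at x) (cmap (chart_at x) p) = p := flX.1.2.

Lemma flat_tb : flat_atlas tb.
Proof. exact: flat_atlas_prod flX (@stab_flat C n). Qed.

Lemma tb_cmapE (e e' : tb) : cmap (chart_at e) e' =
  row_mx (cmap (chart_at e.1) e'.1) (hprj (hmx e'.2)).
Proof. by []. Qed.

Lemma tb_cinvE (e : tb) y : cinv (chart_at e) y =
  (cinv (chart_at e.1) (lsubmx y), scl (nu (rsubmx y))).
Proof. by []. Qed.

Lemma tb_near (e e' : tb) : cdom (chart_at e.1) e'.1 ->
  \forall y \near cmap (chart_at e) e',
   [/\ cdom (chart_at e.1) (cinv (chart_at e.1) (lsubmx y)),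
       cmap (chart_at e.1) (cinv (chart_at e.1) (lsubmx y)) = lsubmx y &
       nu (rsubmx y) \in unitmx].
Proof.
move=> de; have := near_row_mx (flat_near flX de) (nu_unit_near e'.2).
by apply: filterS => y [[]].
Qed.

Lemma nu_hmx (h : stab C n) : nu (hprj (hmx h)) = hmx h.
Proof. by rewrite nu_hprj ?hmx00 //; exact: hmx_parab. Qed.

Lemma tb_mulE (e : tb) h v :
  mderiv (fun e : tb => ract e h) e v =
  row_mx (lsubmx v) (hprj (nlam (rsubmx v) *m hmx h)).
Proof.
apply: (@mderiv_val _ _ _ _ _ _ _
  (fun v => row_mx (lsubmx v) (hprj (nlam (rsubmx v) *m hmx h)))).
set o := cmap _ _.
have d2 : is_diff o (fun y => hprj (nu (rsubmx y) *m hmx h))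
     (fun v => hprj (nlam (rsubmx v) *m hmx h)).
  have d1 := is_diff_mulmx (is_diff_then (nu_is_diff (rsubmx o)) (is_diff_rsub o))
     (is_diff_const (hmx h) o).
  have d2 := is_diff_then (is_diff_linear _ (@hprj_linear C n)) d1.
  by apply: (is_diff_ext d2) => w /=; rewrite mulmx0 addr0.
apply: is_diff_near (is_diff_row_mx (is_diff_lsub o) d2).
apply: filterS (tb_near (dX e.1)) => y [_ E uy].
transitivity (row_mx (cmap (chart_at e.1) (cinv (chart_at e.1) (lsubmx y)))
  (hprj (hmx (scl (nu (rsubmx y)) * h)%g))) => //.
by rewrite E hmxM hmx_scl_nu.
Qed.

Lemma tb_vertE (e : tb) (u : 'rV[C]_m) : vert e u = row_mx 0 (hprj (hmx e.2 *m nlam u)).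
Proof.
apply: (@mderiv_val _ _ _ _ _ _ _ (fun u => row_mx 0 (hprj (hmx e.2 *m nlam u)))).
rewrite stab_cmapE; set o := hprj _.
have d2 : is_diff o (fun y => hprj (hmx e.2 *m nu y)) (fun v => hprj (hmx e.2 *m nlam v)).
  have d1 := is_diff_mulmx (is_diff_const (hmx e.2) o) (nu_is_diff o).
  have d2 := is_diff_then (is_diff_linear _ (@hprj_linear C n)) d1.
  by apply: (is_diff_ext d2) => w /=; rewrite mul0mx add0r.
apply: is_diff_near (is_diff_row_mx (is_diff_const (cmap (chart_at e.1) e.1) o) d2).
apply: filterS (nu_unit_near 1%g) => y uy.
transitivity (row_mx (cmap (chart_at e.1) e.1) (hprj (hmx (e.2 * scl (nu y))%g))) => //.
by rewrite hmxM hmx_scl_nu.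
Qed.

Lemma nlam_mul (v : 'rV[C]_m) (h : stab C n) :
  nlam (hprj (nlam v *m hmx h)) = nlam v *m hmx h.
Proof.
rewrite nlam_hprj //; last by rewrite parab_idx ?nlam00 ?mul0r //; exact: hmx_parab.
by apply: parabM; [exact: nlam_parab|exact: hmx_parab].
Qed.

Lemma nlam_lmul (v : 'rV[C]_m) (h : stab C n) :
  nlam (hprj (hmx h *m nlam v)) = hmx h *m nlam v.
Proof.
rewrite nlam_hprj //; last by rewrite parab_idx ?nlam00 ?mulr0 //; exact: nlam_parab.
by apply: parabM; [exact: hmx_parab|exact: nlam_parab].
Qed.

Lemma tb_at_act1 (q : tangentm tb) : at_act (E := tb) q 1%g = q.
Proof.
case: q => -[x h] v; rewrite /at_act tb_mulE /= mulg1 hmx1 mulmx1 hprj_nlam.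
by rewrite hsubmxK.
Qed.

Lemma tb_at_actM (q : tangentm tb) (g h : stab C n) :
  at_act (E := tb) q (g * h)%g = at_act (E := tb) (at_act (E := tb) q g) h.
Proof.
case: q => -[x l] v; rewrite /at_act !tb_mulE /= mulgA row_mxKl row_mxKr nlam_mul.
by rewrite hmxM mulmxA.
Qed.

Lemma stab_Ad1 (u : 'rV[C]_m) : Ad (1%g : H) u = u.
Proof. by rewrite stab_AdE hmx1 mul1mx invmx1 mulmx1 hprj_nlam. Qed.

Lemma tb_ad_act1 (q : prodm tb (vecm C m)) : ad_act (E := tb) q 1%g = q.
Proof. by case: q => -[x h] u; rewrite /ad_act /= mulg1 invg1 stab_Ad1. Qed.

Lemma is_pbundle_tb : is_manifold tb -> is_pbundle tb.
Proof.
move=> mtb; split.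
- by split => //; exact: flat_fst flX (@stab_flat C n).
- have flEH := flat_atlas_prod flat_tb (@stab_flat C n).
  have nH (q : prodm tb (lgm H)) : \forall y \near cmap (chart_at q) q,
     [/\ cdom (chart_at q.1.1) (cinv (chart_at q.1.1) (lsubmx (lsubmx y))),
       cmap (chart_at q.1.1) (cinv (chart_at q.1.1) (lsubmx (lsubmx y))) =
         lsubmx (lsubmx y), nu (rsubmx (lsubmx y)) \in unitmx &
       nu (rsubmx y) \in unitmx].
    have := near_row_mx (tb_near (dX q.1.1)) (nu_unit_near q.2).
    by apply: filterS => y [[]].
  apply: holoI => //; first exact: flat_tb.1.
    by move=> q; apply: filterS (nH q) => y [].
  move=> q; set o := cmap _ _.
  have d2 : is_diff o (fun y => hprj (nu (rsubmx (lsubmx y)) *m nu (rsubmx y))) _ :=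
    is_diff_then (is_diff_linear _ (@hprj_linear C n))
     (is_diff_mulmx (is_diff_then (nu_is_diff _)
        (is_diff_then (is_diff_rsub _) (is_diff_lsub o)))
      (is_diff_then (nu_is_diff _) (is_diff_rsub o))).
  have d3 := is_diff_row_mx (is_diff_then (is_diff_lsub _) (is_diff_lsub o)) d2.
  apply: differentiable_near d3; apply: filterS (nH q) => y [_ E u1 u2].
  transitivity (row_mx (cmap (chart_at q.1.1) (cinv (chart_at q.1.1) (lsubmx (lsubmx y))))
    (hprj (hmx (scl (nu (rsubmx (lsubmx y))) * scl (nu (rsubmx y)))%g))) => //.
  by rewrite E hmxM !hmx_scl_nu.
- by split=> [[x h]|[x h] g l] /=; rewrite ?mulg1 // mulgA.
- by [].
- move=> x; split=> //.
  + split=> //; apply: holoI => //; first exact: flat_tb.1.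
      by move=> y; apply: filterS (flat_near flX (dX y)) => t [].
    move=> y; set o := cmap _ _.
    apply: differentiable_near (is_diff_row_mx
      (is_diff_linear (f := id) o (fun _ _ _ => erefl)) (is_diff_const (hprj (hmx 1%g)) o)).
    apply: filterS (flat_near flX (dX y)) => t [_ E].
    by rewrite /wr /= E.
  + have := flat_snd flX (@stab_flat C n).
    by rewrite /holo (_ : _ @^-1` _ = setT).
  + by move=> [y h] _ /=; rewrite mul1g.
  + by move=> y h _ /=; rewrite mul1g.
Qed.

End TrivialBundle.

Lemma invmx_mulmx (F : comUnitRingType) p (A B : 'M[F]_p) :
  A \in unitmx -> B \in unitmx -> invmx (A *m B) = invmx B *m invmx A.
Proof.
move=> uA uB; have uAB : A *m B \in unitmx by rewrite unitmx_mul uA.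
apply: (can_inj (mulKmx uAB)); rewrite mulmxV // mulmxA -(mulmxA A) mulmxV //.
by rewrite mulmx1 mulmxV.
Qed.

(** * The extended bundle E_G, the form theta and the induced connection *)

Section ExtendedBundle.
Variables (C : numFieldType) (n : nat) (X : manifold C n).
Hypothesis flX : flat_atlas X.
Local Notation M := 'M[C]_n.+1.
Local Notation G := (PGL_lie C n).
Local Notation H := (stab_lie C n).
Local Notation i := (@stab_in C n).
Local Notation k := (n.+1 * n.+1).-1.
Local Notation m := (n + n * n)%N.
Local Notation tb := (trivial_bundle X).
Local Notation Ext := (@ext C n m k X H G i tb).
Local Notation eact := (@ext_act C n m k X H G i tb).
Local Notation eproj := (@ext_proj C n m k X H G i tb).
Local Notation ein := (@ext_in C n m k X H G i tb).

Let dX : forall x : X, cdom (chart_at x) x := flX.1.1.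
Let cX : forall x p : X, cdom (chart_at x) p ->
  cinv (chart_at x) (cmap (chart_at x) p) = p := flX.1.2.

(* With [ext_proj], identifies the extended bundle with X x G. *)
Definition ext_gpart (z : Ext) : PGL C n := (val (rep z).1.2 * (rep z).2)%g.
Local Notation gg := ext_gpart.

Lemma ext_act1 q : eact q 1%g = q.
Proof.
case: q => -[x h] g; rewrite /ext_act /= mulg1.
by rewrite (_ : i 1%g = 1%g) // invg1 mul1g.
Qed.

Lemma ext_actM q (h l : H) : eact q (h * l)%g = eact (eact q h) l.
Proof.
case: q => -[x h0] g; rewrite /ext_act /= mulgA.
by rewrite (_ : i (h * l)%g = (i h * i l)%g) // invgM mulgA.
Qed.

Lemma eproj_cl (e : tb) (g : G) : eproj (cl eact (e, g)) = e.1.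
Proof. by rewrite /ext_proj; have [h ->] := rep_cl ext_act1 (e, g). Qed.

Lemma gg_cl (e : tb) (g : G) : gg (cl eact (e, g)) = (val e.2 * g)%g.
Proof.
rewrite /gg; have [h ->] := rep_cl ext_act1 (e, g).
by rewrite /= /stab_in -mulgA mulVKg.
Qed.

Lemma extE (z : Ext) : z = cl eact ((eproj z, 1%g), gg z).
Proof.
rewrite -[LHS]repK -(cl_act ext_actM _ ((rep z).1.2)^-1%g); congr cl.
rewrite /ext_act /ext_proj /gg; case: (rep z) => -[x h] g /=.
by rewrite mulgV (_ : i h^-1%g = (i h)^-1%g) // invgK.
Qed.

Lemma ext_eq (z z' : Ext) : eproj z = eproj z' -> gg z = gg z' -> z = z'.
Proof. by move=> Ep Eg; rewrite (extE z) (extE z') Ep Eg. Qed.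

Lemma eproj_ract (z : Ext) (g : G) : eproj (ract z g) = eproj z.
Proof. exact: eproj_cl. Qed.

Lemma gg_ract (z : Ext) (g : G) : gg (ract z g) = (gg z * g)%g.
Proof. by rewrite [LHS]gg_cl mulgA. Qed.

Lemma ext_ract1 (z : Ext) : ract z (1%g : G) = z.
Proof.
apply: ext_eq; first exact: eproj_ract.
by rewrite gg_ract mulg1.
Qed.

Lemma ext_ractM (z : Ext) (g h : G) : ract z (g * h)%g = ract (ract z g) h.
Proof.
apply: ext_eq; first by rewrite !eproj_ract.
by rewrite !gg_ract mulgA.
Qed.

Lemma eproj_in (e : tb) : eproj (ein e) = e.1.
Proof. exact: eproj_cl. Qed.

Lemma gg_in (e : tb) : gg (ein e) = val e.2.
Proof. by rewrite gg_cl mulg1. Qed.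

Lemma ext_in_ract (e : tb) (h : H) : ein (ract e h) = ract (ein e) (i h).
Proof.
apply: ext_eq; first by rewrite eproj_ract !eproj_in.
by rewrite gg_ract !gg_in.
Qed.

Lemma ext_from_in (z : Ext) : z = ract (ein (eproj z, 1%g)) (gg z : G).
Proof.
apply: ext_eq; first by rewrite eproj_ract eproj_in.
by rewrite gg_ract gg_in mul1g.
Qed.

Lemma ext_cmapE (z z' : Ext) : cmap (chart_at z) z' =
  row_mx (cmap (chart_at (eproj z)) (eproj z')) (kap (pidx (gg z)) (rmx (gg z'))).
Proof. by []. Qed.

Lemma eproj_cinv (z : Ext) y : eproj (cinv (chart_at z) y) =
  cinv (chart_at (eproj z)) (lsubmx y).
Proof. exact: eproj_cl. Qed.

Lemma gg_cinv (z : Ext) y : gg (cinv (chart_at z) y) = pcl (mu (pidx (gg z)) (rsubmx y)).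
Proof. by rewrite [LHS]gg_cl mul1g. Qed.

Lemma kap_rmx_pcl (s : 'I_n.+1 * 'I_n.+1) (A : M) : A \in unitmx ->
  kap s (rmx (pcl A)) = kap s A.
Proof. exact: PGL_cmapE. Qed.

Lemma row_kap_eq (p p' q q' : X) (g g' h h' : PGL C n) :
  p = p' -> q = q' -> g = g' -> h = h' ->
  row_mx (cmap (chart_at p) q) (kap (pidx g) (rmx h)) =
  row_mx (cmap (chart_at p') q') (kap (pidx g') (rmx h')).
Proof. by move=> -> -> -> ->. Qed.

Lemma pidx_neq0 (A : M) g : A \in unitmx -> pcl A = g ->
  A (pidx g).1 (pidx g).2 != 0.
Proof.
move=> uA <-; have [c c0 E] := rmx_pcl uA; have := pidxP (pcl A).
by move=> H0; rewrite {1}E mxE mulf_neq0.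
Qed.

Lemma dkap_scale (s : 'I_n.+1 * 'I_n.+1) c (A B : M) : c != 0 ->
  A s.1 s.2 = 1 -> B s.1 s.2 = 0 -> dkap s (c *: A) (c *: B) = prj s B.
Proof.
move=> c0 A1 B0; rewrite /dkap [(c *: B) _ _]mxE [(c *: A) _ _]mxE A1 B0 !mulr0.
by rewrite scale0r subr0 mulr1 scalerA mulVf // scale1r.
Qed.

(* The matrix representing [gg z] with entry 1 at [pidx (gg z)]. *)
Definition nrm (z : Ext) : M := mu (pidx (gg z)) (kap (pidx (gg z)) (rmx (gg z))).

Lemma nrm_unit z : nrm z \in unitmx.
Proof. by apply: mu_kap_unit; [exact: rmx_unit|exact: pidxP]. Qed.

Lemma pcl_nrm z : pcl (nrm z) = gg z.
Proof.
rewrite -[RHS]pcl_rmx; apply/esym/pclP; rewrite ?nrm_unit ?rmx_unit //.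
rewrite /nrm mu_kap ?pidxP //; eexists; last by [].
by rewrite invr_eq0 pidxP.
Qed.

Lemma ext_near (z : Ext) : \forall y \near cmap (chart_at z) z,
   [/\ cdom (chart_at (eproj z)) (cinv (chart_at (eproj z)) (lsubmx y)),
       cmap (chart_at (eproj z)) (cinv (chart_at (eproj z)) (lsubmx y)) = lsubmx y &
       mu (pidx (gg z)) (rsubmx y) \in unitmx].
Proof.
have := near_row_mx (flat_near flX (dX (eproj z))) (mu_unit_near (rmx_unit (gg z)) (pidxP _)).
by apply: filterS => y [[]].
Qed.

Lemma weak_atlas_ext : weak_atlas Ext.
Proof.
split=> [z|z w [_ dw dg]].
  by split; [|exact: dX|exact: pidxP].
apply: ext_eq; first by rewrite eproj_cinv ext_cmapE row_mxKl cX.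
rewrite gg_cinv ext_cmapE row_mxKr mu_kap // -[RHS]pcl_rmx; apply/esym/pclP; rewrite ?rmx_unit //.
  by rewrite unitmxZ ?rmx_unit // unitfE invr_eq0.
by eexists; last by []; rewrite invr_eq0.
Qed.

Variable w : 'rV[C]_n -> M.
Hypothesis w_linear : linear w.

(* Ad(N^-1) w + N^-1 dN on the tangent vector with components [a] along X and [B]
   along the matrices. *)
Definition lifted_form (N : M) (a : 'rV[C]_n) (B : M) := pgl (invmx N *m (w a *m N + B)).

Definition ext_form (z : Ext) (v : 'rV[C]_(n + k)) :=
  lifted_form (nrm z) (lsubmx v) (lam (pidx (gg z)) (rsubmx v)).

Definition tb_form (e : tb) (v : 'rV[C]_(n + m)) :=
  lifted_form (hmx e.2) (lsubmx v) (nlam (rsubmx v)).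

Lemma pglD (A B : M) : pgl (A + B) = pgl A + pgl B.
Proof. by have := pgl_linear 1 A B; rewrite !scale1r. Qed.

Lemma pglZ c (A : M) : pgl (c *: A) = c *: pgl A.
Proof.
by have := pgl_linear c A (0%:M); rewrite pgl_scalar !addr0 raddf0 addr0.
Qed.

Lemma w0 : w 0 = 0.
Proof. by have := w_linear (-1) 0 0; rewrite !scaleN1r !addNr. Qed.

Lemma lifted_form_linear N c a a' B B' :
  lifted_form N (c *: a + a') (c *: B + B') = c *: lifted_form N a B + lifted_form N a' B'.
Proof.
rewrite /lifted_form -pglZ -pglD; congr pgl.
rewrite w_linear mulmxDl addrACA -scalemxAl -scalerDr mulmxDr.
by rewrite -scalemxAr.
Qed.

(** Normalising the lift [P] multiplies it by a scalar function: the Maurer-Cartan term changes by a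
    scalar matrix, killed by [pgl], and conjugation does not see the factor. *)
Lemma lifted_form_dkap s (P : M) a B : P \in unitmx -> P s.1 s.2 != 0 ->
  lifted_form (mu s (kap s P)) a (lam s (dkap s P B)) = lifted_form P a B.
Proof.
move=> uP P0; rewrite /lifted_form !mulmxDr !pglD mc_dkap //; congr (_ + _).
rewrite mu_kap // invmxZ ?unitmxZ ?unitfE ?invr_eq0 // invrK.
by rewrite -!scalemxAr -!scalemxAl scalerA mulVf // scale1r.
Qed.

Lemma ext_form_dkap (z : Ext) (P : M) a B : P \in unitmx -> pcl P = gg z ->
  ext_form z (row_mx a (dkap (pidx (gg z)) P B)) = lifted_form P a B.
Proof.
move=> uP E; rewrite /ext_form row_mxKl row_mxKr /nrm -[X in rmx X]E kap_rmx_pcl //.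
by rewrite lifted_form_dkap // pidx_neq0.
Qed.

Lemma ext_form_linear z : linear (ext_form z).
Proof.
by move=> c u v; rewrite /ext_form -lifted_form_linear !linearD !linearZ /= lam_linear.
Qed.

Lemma tb_form_linear e : linear (tb_form e).
Proof.
by move=> c u v; rewrite /tb_form -lifted_form_linear !linearD !linearZ /= nlam_linear.
Qed.

Lemma ext_mulE (z : Ext) (g : G) v :
  mderiv (fun z : Ext => ract z g) z v =
  row_mx (lsubmx v) (dkap (pidx (gg (ract z g))) (nrm z *m rmx g)
    (lam (pidx (gg z)) (rsubmx v) *m rmx g)).
Proof.
move: v; apply: (@mderiv_val _ _ _ _ _ _ _ (fun v => row_mx (lsubmx v)
  (dkap (pidx (gg (ract z g))) (nrm z *m rmx g)
    (lam (pidx (gg z)) (rsubmx v) *m rmx g)))).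
set o := cmap _ _; set s' := pidx _.
have uP : nrm z *m rmx g \in unitmx by rewrite unitmx_mul nrm_unit rmx_unit.
have P0 : (nrm z *m rmx g) s'.1 s'.2 != 0.
  by apply: pidx_neq0 => //; rewrite -pclM ?nrm_unit ?rmx_unit // pcl_nrm pcl_rmx gg_ract.
have oE : mu (pidx (gg z)) (rsubmx o) *m rmx g = nrm z *m rmx g.
  by rewrite /o ext_cmapE row_mxKr.
have d2 : is_diff o (fun y => kap s' (mu (pidx (gg z)) (rsubmx y) *m rmx g))
     (fun v => dkap s' (nrm z *m rmx g) (lam (pidx (gg z)) (rsubmx v) *m rmx g)).
  have d1 := is_diff_mulmx (is_diff_then (mu_is_diff (pidx (gg z)) (rsubmx o)) (is_diff_rsub o))
     (is_diff_const (rmx g) o).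
  have d2 := @kap_is_diff _ _ _ s' _ _ o _ d1; rewrite oE in d2.
  by apply: (is_diff_ext (d2 P0)) => v /=; rewrite mulmx0 addr0.
apply: is_diff_near (is_diff_row_mx (is_diff_lsub o) d2).
apply: filterS (ext_near z) => y [_ E uy].
transitivity (row_mx
   (cmap (chart_at (eproj (ract z g))) (eproj (ract (cinv (chart_at z) y) g)))
   (kap s' (rmx (gg (ract (cinv (chart_at z) y) g))))) => //.
rewrite !eproj_ract eproj_cinv E gg_ract gg_cinv -[X in (_ * X)%g]pcl_rmx.
by rewrite pclM ?rmx_unit // kap_rmx_pcl // unitmx_mul uy rmx_unit.
Qed.

Lemma ext_inE (e : tb) v : mderiv (M := tb) (N := Ext) ein e v =
  row_mx (lsubmx v) (dkap (pidx (gg (ein e))) (hmx e.2) (nlam (rsubmx v))).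
Proof.
move: v; apply: (@mderiv_val _ _ _ _ _ _ _ (fun v => row_mx (lsubmx v)
  (dkap (pidx (gg (ein e))) (hmx e.2) (nlam (rsubmx v))))).
set o := cmap _ _; set s' := pidx _.
have P0 : (hmx e.2) s'.1 s'.2 != 0.
  by apply: pidx_neq0; rewrite ?hmx_unit // gg_in pcl_hmx.
have oE : nu (rsubmx o) = hmx e.2 by rewrite /o tb_cmapE row_mxKr nu_hmx.
have d2 : is_diff o (fun y => kap s' (nu (rsubmx y)))
     (fun v => dkap s' (hmx e.2) (nlam (rsubmx v))).
  have d2 := @kap_is_diff _ _ _ s' _ _ o _ (is_diff_then (nu_is_diff (rsubmx o)) (is_diff_rsub o)).
  by rewrite oE in d2; exact: d2.
apply: is_diff_near (is_diff_row_mx (is_diff_lsub o) d2).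
apply: filterS (tb_near flX (dX e.1)) => y [_ E uy].
transitivity (row_mx
   (cmap (chart_at (eproj (ein e))) (eproj (ein (cinv (chart_at e) y))))
   (kap s' (rmx (gg (ein (cinv (chart_at e) y)))))) => //.
rewrite !eproj_in tb_cinvE E gg_in -pcl_hmx hmx_scl_nu //.
by rewrite kap_rmx_pcl.
Qed.

Lemma ext_vertE (z : Ext) (u : 'rV[C]_k) : vert z u =
  row_mx 0 (dkap (pidx (gg z)) (nrm z) (nrm z *m lam (s1 C n) u)).
Proof.
move: u; apply: (@mderiv_val _ _ _ _ _ _ _ (fun u => row_mx 0
  (dkap (pidx (gg z)) (nrm z) (nrm z *m lam (s1 C n) u)))).
rewrite PGL_cmap1; set o := kap _ _; set s' := pidx _.
have P0 : (nrm z) s'.1 s'.2 != 0 by apply: pidx_neq0; rewrite ?nrm_unit // pcl_nrm.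
have oE : nrm z *m mu (s1 C n) o = nrm z by rewrite mu1 mulmx1.
have d2 : is_diff o (fun y => kap s' (nrm z *m mu (s1 C n) y))
     (fun u => dkap s' (nrm z) (nrm z *m lam (s1 C n) u)).
  have d1 := is_diff_mulmx (is_diff_const (nrm z) o) (mu_is_diff (s1 C n) o).
  have d2 := @kap_is_diff _ _ _ s' _ _ o _ d1; rewrite oE in d2.
  by apply: (is_diff_ext (d2 P0)) => v /=; rewrite mul0mx add0r.
apply: is_diff_near (is_diff_row_mx (is_diff_const (cmap (chart_at (eproj z)) (eproj z)) o) d2).
have : \forall y \near o, mu (s1 C n) y \in unitmx.
  by apply: mu_unit_near; rewrite ?unitmx1 // one_s1 oner_neq0.
apply: filterS => y uy.
transitivity (row_mx
   (cmap (chart_at (eproj (ract z (1%g : G)))) (eproj (ract z (pcl (mu (s1 C n) y) : G))))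
   (kap (pidx (gg (ract z (1%g : G)))) (rmx (gg (ract z (pcl (mu (s1 C n) y) : G)))))) => //.
have E1 : gg (ract z (1%g : G)) = gg z by rewrite gg_ract mulg1.
have E2 : gg (ract z (pcl (mu (s1 C n) y) : G)) = pcl (nrm z *m mu (s1 C n) y).
  by rewrite gg_ract -(pclM (nrm_unit z) uy) pcl_nrm.
have u2 : nrm z *m mu (s1 C n) y \in unitmx by rewrite unitmx_mul nrm_unit.
rewrite -[X in row_mx _ X](kap_rmx_pcl s' u2).
by apply: row_kap_eq; apply/esym; [exact: eproj_ract|exact: eproj_ract|exact: E1|exact: E2].
Qed.

(** Equivariance: this is why the form descends to a map from At(E_G) to ad(E_G). *)
Lemma ext_form_mul (z : Ext) (g : G) v :
  ext_form (ract z g) (mderiv (fun z : Ext => ract z g) z v) = Ad (g^-1)%g (ext_form z v).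
Proof.
have ug := rmx_unit g.
rewrite ext_mulE ext_form_dkap; last 2 first.
- by rewrite unitmx_mul nrm_unit.
- by rewrite -pclM ?nrm_unit // pcl_nrm pcl_rmx gg_ract.
rewrite -[X in Ad X^-1%g]pcl_rmx pclV // PGL_AdE ?unitmx_inv // invmxK.
rewrite /ext_form /lifted_form pgl_conj_lam //; congr pgl.
have -> : invmx (nrm z *m rmx g) = invmx (rmx g) *m invmx (nrm z).
  by rewrite invmx_mulmx ?nrm_unit.
by rewrite mulmxA -mulmxDl !mulmxA.
Qed.

Lemma ext_form_in (e : tb) v : ext_form (ein e) (mderiv (M := tb) (N := Ext) ein e v) = tb_form e v.
Proof. by rewrite ext_inE ext_form_dkap ?hmx_unit // gg_in pcl_hmx. Qed.

(** The form reproduces the generators of fundamental vector fields; together with [ext_form_in] and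
    linearity this yields the defining property of theta'. *)
Lemma ext_form_vert (z : Ext) u : ext_form z (vert z u) = u.
Proof.
rewrite ext_vertE ext_form_dkap ?nrm_unit ?pcl_nrm // /lifted_form w0 mul0mx add0r.
by rewrite mulKmx ?nrm_unit // pgl_lam.
Qed.

Lemma tb_form_mul (e : tb) (h : H) v :
  tb_form (ract e h) (mderiv (fun e : tb => ract e h) e v) = Ad ((i h)^-1)%g (tb_form e v).
Proof.
rewrite tb_mulE // /tb_form row_mxKl row_mxKr nlam_mul /= hmxM.
rewrite /stab_in -pcl_hmx pclV ?hmx_unit // PGL_AdE ?unitmx_inv ?hmx_unit // invmxK.
rewrite /lifted_form pgl_conj_lam ?hmx_unit //; congr pgl.
rewrite invmx_mulmx ?hmx_unit //.
by rewrite (mulmxA (w _)) -mulmxDl !mulmxA.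
Qed.

Lemma tb_form_vert (e : tb) u : tb_form e (vert e u) = lie_in i u.
Proof.
rewrite tb_vertE /tb_form row_mxKl row_mxKr nlam_lmul /lifted_form w0 mul0mx add0r.
by rewrite mulKmx ?hmx_unit // stab_lie_inE.
Qed.

Lemma PGL_Ad1 u : Ad (1%g : G) u = u.
Proof. by rewrite -pcl1 PGL_AdE ?unitmx1 // invmx1 mul1mx mulmx1 pgl_lam. Qed.

Lemma PGL_AdM (g h : G) u : Ad (g * h)%g u = Ad g (Ad h u).
Proof.
have [ug uh] := (rmx_unit g, rmx_unit h).
rewrite -(pcl_rmx g) -(pcl_rmx h) pclM // !PGL_AdE ?unitmx_mul ?ug ?uh //.
have := @pgl_conj_lam C n (invmx (rmx g)) (rmx h *m lam (s1 C n) u *m invmx (rmx h)).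
rewrite invmxK unitmx_inv => /(_ ug) ->.
by rewrite invmx_mulmx // !mulmxA.
Qed.

Lemma ext_ad_act1 (q : prodm Ext (vecm C k)) : ad_act (E := Ext) q (1%g : G) = q.
Proof. by case: q => z u; rewrite /ad_act ext_ract1 invg1 PGL_Ad1. Qed.

Lemma ext_ad_actM (q : prodm Ext (vecm C k)) (g h : G) :
  ad_act (E := Ext) q (g * h)%g = ad_act (E := Ext) (ad_act (E := Ext) q g) h.
Proof.
case: q => z u; apply: (congr2 pair (ext_ractM z g h)).
exact: (etrans (congr1 (fun x : G => Ad x u) (invgM g h)) (PGL_AdM _ _ _)).
Qed.

Lemma ad_cl_ract (z : Ext) (g : G) u : ad_cl (ract z g) (Ad g^-1%g u) = ad_cl z u.
Proof. exact: (cl_act ext_ad_actM (z, u) g). Qed.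

(** The structure group acts freely on frames, so a frame determines the coordinate. *)
Lemma ad_cl_inj (z : Ext) u v : ad_cl z u = ad_cl z v -> u = v.
Proof.
move=> /(cl_eq_act ext_ad_act1) [g [Ez ->]].
have : gg z = (gg z * g)%g := etrans (congr1 gg Ez) (gg_ract z g).
rewrite -[X in X = _ -> _]mulg1 => /mulgI <-.
by rewrite invg1 PGL_Ad1.
Qed.

Lemma ad_coordE (z : Ext) u : ad_coord z (ad_cl z u) = u.
Proof.
rewrite /ad_coord; case: xgetP => [v _ /= /ad_cl_inj //|/(_ u)].
by move/(_ erefl).
Qed.

Lemma ext_at_act1 (q : tangentm Ext) : at_act (E := Ext) q (1%g : G) = q.
Proof.
case: q => z v; apply: (congr2 pair (ext_ract1 z)).
apply: (etrans (ext_mulE z (1%g : G) v)).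
have E1 : gg (ract z (1%g : G)) = gg z := congr1 gg (ext_ract1 z).
rewrite E1.
(* The chosen representative of 1 need not be the identity matrix, only a scalar multiple of it. *)
have [c c0 E] := rmx_pcl (unitmx1 C n.+1); rewrite pcl1 in E.
have -> : rmx (1%g : PGL C n) = c^-1%:M by rewrite -scalemx1 E scalerA mulVf ?scale1r.
rewrite !mul_mx_scalar dkap_scale ?invr_eq0 ?lam_idx ?mu_idx // lamK.
exact: hsubmxK.
Qed.

(** Read off the chosen representative; [thetaE] shows that any other representative gives the same
    value. *)
Definition theta (a : At tb) : ad Ext := ad_cl (ein (rep a).1) (tb_form (rep a).1 (rep a).2).

Definition conn (a : At Ext) : ad Ext := ad_cl (rep a).1 (ext_form (rep a).1 (rep a).2).

Lemma thetaE (e : tb) v : theta (at_cl e v) = ad_cl (ein e) (tb_form e v).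
Proof.
rewrite /theta; have [h ->] := rep_cl (tb_at_act1 flX) (e, v).
by rewrite tb_form_mul ext_in_ract ad_cl_ract.
Qed.

Lemma connE (z : Ext) v : conn (at_cl z v) = ad_cl z (ext_form z v).
Proof.
rewrite /conn; have [g ->] := rep_cl ext_at_act1 (z, v).
by rewrite ext_form_mul ad_cl_ract.
Qed.

Lemma conn_def (e : tb) v u :
  conn (at_cl (ein e) (mderiv (M := tb) (N := Ext) ein e v + vert (ein e) u)) =
  ad_cl (ein e) (ad_coord (ein e) (theta (at_cl e v)) + u).
Proof.
rewrite connE thetaE ad_coordE; congr ad_cl.
have := ext_form_linear (ein e) 1 (mderiv (M := tb) (N := Ext) ein e v) (vert (ein e) u).
by rewrite !scale1r ext_form_in ext_form_vert.
Qed.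

Lemma theta_linear (e : tb) : exists L : {linear 'rV[C]_(n + m) -> 'rV[C]_k},
  forall v, theta (at_cl e v) = ad_cl (ein e) (L v).
Proof.
pose LM := GRing.isLinear.Build _ _ _ _ _ (tb_form_linear e).
pose L : {linear _ -> _} := HB.pack (tb_form e) LM.
by exists L => v; rewrite thetaE.
Qed.

Lemma theta_iota (b : ad tb) : theta (iota2 b) = iota1 i b.
Proof. by rewrite /iota2 /iota1 thetaE tb_form_vert. Qed.

End ExtendedBundle.

(** * Curvature of the connection *)

Section Curvature.
Variables (C : numFieldType) (n : nat) (X : manifold C n).
Hypothesis flX : flat_atlas X.
Local Notation M := 'M[C]_n.+1.
Local Notation G := (PGL_lie C n).
Local Notation H := (stab_lie C n).
Local Notation i := (@stab_in C n).
Local Notation k := (n.+1 * n.+1).-1.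
Local Notation m := (n + n * n)%N.
Local Notation tb := (trivial_bundle X).
Local Notation Ext := (@ext C n m k X H G i tb).
Local Notation eproj := (@ext_proj C n m k X H G i tb).
Local Notation ein := (@ext_in C n m k X H G i tb).
Local Notation gg := (@ext_gpart C n X).

Variable w : 'rV[C]_n -> M.
Hypothesis w_linear : linear w.
Local Notation lifted_form := (lifted_form w).
Local Notation ext_form := (ext_form w).
Local Notation conn := (@conn C n X w).

Let dX : forall x : X, cdom (chart_at x) x := flX.1.1.

Lemma conn_formE (z : Ext) v : conn_form conn z v = ext_form z v.
Proof. by rewrite /conn_form connE // ad_coordE. Qed.

(** Passage from the chart at [z] to the chart at the moving point [z']. Flatness of X makes the
    base component the identity; only the fibre component is corrected. *)
Lemma ext_of_chartE (z : Ext) y t (s := pidx (gg z)) (z' := cinv (chart_at z) y : Ext) :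
  cdom (chart_at (eproj z)) (cinv (chart_at (eproj z)) (lsubmx y)) ->
  cmap (chart_at (eproj z)) (cinv (chart_at (eproj z)) (lsubmx y)) = lsubmx y ->
  mu s (rsubmx y) \in unitmx ->
  of_chart (chart_at z) y t =
  row_mx (lsubmx t) (dkap (pidx (gg z')) (mu s (rsubmx y)) (lam s (rsubmx t))).
Proof.
move=> dy Ey uy.
suff D : is_diff y (cmap (chart_at z') \o cinv (chart_at z))
   (fun t => row_mx (lsubmx t) (dkap (pidx (gg z')) (mu s (rsubmx y)) (lam s (rsubmx t)))).
  exact: (congr1 (fun g : 'rV[C]_(n + k) -> 'rV[C]_(n + k) => g t) (@diff_val _ _ _ _ _ _ _ D)).
have gz' : gg z' = pcl (mu s (rsubmx y)) := gg_cinv z y.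
have P0 : (mu s (rsubmx y)) (pidx (gg z')).1 (pidx (gg z')).2 != 0.
  exact: pidx_neq0 uy (esym gz').
have d1 : is_diff y (fun y' => cmap (chart_at (eproj z'))
    (cinv (chart_at (eproj z)) (lsubmx y'))) lsubmx.
  have := flat_transition_is_diff flX dy; rewrite Ey => D.
  have -> : eproj z' = cinv (chart_at (eproj z)) (lsubmx y) := eproj_cinv z y.
  exact: is_diff_then D (is_diff_lsub y).
have d2 := is_diff_then (mu_is_diff s (rsubmx y)) (is_diff_rsub y).
have d3 := @kap_is_diff _ _ _ (pidx (gg z')) _ _ y _ d2.
apply: is_diff_near (is_diff_row_mx d1 (d3 P0)).
have nu : \forall y' \near y, mu s (rsubmx y') \in unitmx.
  have [c _] := d2; exact: (differentiable_continuous c (unitmx_near uy)).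
apply: filterS nu => y' uy'.
transitivity (row_mx (cmap (chart_at (eproj z')) (eproj (cinv (chart_at z) y')))
  (kap (pidx (gg z')) (rmx (gg (cinv (chart_at z) y'))))) => //.
rewrite -(kap_rmx_pcl _ uy').
by apply: row_kap_eq => //; apply/esym; [exact: eproj_cinv|exact: gg_cinv].
Qed.

(** The chart at the moving point may jump with [y]. Independence of the lift removes it and leaves
    an expression in the fixed chart at [z], which can be differentiated. *)
Lemma conn_form_near (z : Ext) t (s := pidx (gg z)) :
  \forall y \near cmap (chart_at z) z,
    lifted_form (mu s (rsubmx y)) (lsubmx t) (lam s (rsubmx t)) =
    conn_form conn (cinv (chart_at z) y) (of_chart (chart_at z) y t).
Proof.
apply: filterS (ext_near flX z) => y [dy Ey uy].
rewrite conn_formE ext_of_chartE // ext_form_dkap //.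
by rewrite gg_cinv.
Qed.

(** Derivative of [lifted_form N a W] with respect to [N] along [U]; the first term is that of the
    inverse of [N]. There is no derivative along X because [w] has constant coefficients. *)
Definition dlifted_form (N U W : M) (a : 'rV[C]_n) : 'rV[C]_k :=
  pgl (- (invmx N *m U *m invmx N) *m (w a *m N + W) + invmx N *m (w a *m U)).

Lemma conn_form_is_diff (z : Ext) t (s := pidx (gg z)) :
  is_diff (cmap (chart_at z) z)
    (fun y => conn_form conn (cinv (chart_at z) y) (of_chart (chart_at z) y t))
    (fun u => dlifted_form (nrm z) (lam s (rsubmx u)) (lam s (rsubmx t)) (lsubmx t)).
Proof.
apply: is_diff_near (conn_form_near z t) _; set o := cmap _ _.
have oE : mu s (rsubmx o) = nrm z by rewrite /o ext_cmapE row_mxKr.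
have d1 := is_diff_then (mu_is_diff s (rsubmx o)) (is_diff_rsub o).
have uo : mu s (rsubmx o) \in unitmx by rewrite oE nrm_unit.
have d2 := @is_diff_invmx _ _ _ (fun y => mu s (rsubmx y)) _ o uo d1.
have d3 := is_diff_mulmx (is_diff_const (w (lsubmx t)) o) d1.
have d4 := is_diff_mulmx d2 (is_diff_add d3 (is_diff_const (lam s (rsubmx t)) o)).
have d5 := is_diff_then (is_diff_linear _ (@pgl_linear C n)) d4.
apply: (is_diff_ext d5) => u /=; rewrite /dlifted_form oE.
by rewrite mul0mx add0r addr0.
Qed.

(** Scalar matrices are central, so they drop out of commutators. *)
Lemma pgl_comm (A B : M) :
  pgl (lam (s1 C n) (pgl A) *m lam (s1 C n) (pgl B) -
       lam (s1 C n) (pgl B) *m lam (s1 C n) (pgl A)) = pgl (A *m B - B *m A).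
Proof.
rewrite !lam_pgl; set a := A _ _; set b := B _ _; congr pgl.
rewrite !mulmxBl !mulmxBr !mul_scalar_mx !mul_mx_scalar.
rewrite !scale_scalar_mx [b * a]mulrC.
move: (A *m B) (B *m A) (b *: A) (a *: B) (a * b)%:M => x1 x2 x3 x4 x5.
by apply/matrixP => p q; rewrite !mxE; ring.
Qed.

(* The Maurer-Cartan terms cancel: only the bracket of [w] remains. *)
Lemma curvature_identity (N U V : M) (a b : 'rV[C]_n) : N \in unitmx ->
  dlifted_form N U V b - dlifted_form N V U a + pgl (
    (invmx N *m (w a *m N + U)) *m (invmx N *m (w b *m N + V)) -
    (invmx N *m (w b *m N + V)) *m (invmx N *m (w a *m N + U))) =
  pgl (invmx N *m (w a *m w b - w b *m w a) *m N).
Proof.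
move=> uN; rewrite /dlifted_form.
have pglN (A : M) : - pgl A = pgl (- A) by rewrite -scaleN1r -pglZ scaleN1r.
rewrite pglN -!pglD; congr pgl.
(* Inserting N N^-1 turns every term into a product of the four matrices N^-1 w(a) N, N^-1 w(b) N,
   N^-1 U and N^-1 V. *)
have E (Y Z : M) : invmx N *m (Y *m Z) = invmx N *m Y *m N *m (invmx N *m Z).
  by rewrite -[RHS]mulmxA mulKVmx // mulmxA.
rewrite mulmxBr mulmxBl (E (w a) (w b)) (E (w b) (w a)) -!(mulmxA _ (invmx N *m _) N).
rewrite (E (w b) U) (E (w a) V).
rewrite !mulNmx -!(mulmxA _ (invmx N) _) !(mulmxDr (invmx N)).
rewrite !(mulmxA (invmx N) (w _) N).
move: (invmx N *m w a *m N) (invmx N *m w b *m N) (invmx N *m U) (invmx N *m V) => A B P Q.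
rewrite !mulmxDl !mulmxDr.
(* Once the noncommutative monomials are variables, the identity is additive and [ring] checks it
   entry by entry. *)
move: (P *m B) (P *m Q) (B *m P) (Q *m A) (Q *m P) (A *m Q) (A *m B) (B *m A).
move=> x1 x2 x3 x4 x5 x6 x7 x8.
by apply/matrixP => p q; rewrite !mxE; ring.
Qed.

Lemma curvE (z : Ext) u v : curv conn z u v =
  ad_cl z (pgl (invmx (nrm z) *m
    (w (lsubmx u) *m w (lsubmx v) - w (lsubmx v) *m w (lsubmx u)) *m nrm z)).
Proof.
rewrite -(curvature_identity (lam (pidx (gg z)) (rsubmx u))
  (lam (pidx (gg z)) (rsubmx v)) _ _ (nrm_unit z)).
rewrite /curv; congr (ad_cl z _).
rewrite !conn_formE lie_bracketE pgl_comm.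
congr (_ + _); rewrite /conn_d.
have E t s := congr1 (fun g : 'rV[C]_(n + k) -> 'rV[C]_k => g s)
  (@diff_val _ _ _ _ _ _ _ (conn_form_is_diff z t)).
exact: (congr2 (fun a b : 'rV[C]_k => a - b) (E v u) (E u v)).
Qed.

Hypothesis w_parab : forall a b, parab (w a *m w b - w b *m w a).

Lemma ad_cl_in (e : tb) (u : 'rV[C]_m) :
  iota1 i (ad_cl e u) = ad_cl (ein e) (lie_in i u) :> ad Ext.
Proof.
rewrite /iota1; have [h ->] := rep_cl (@tb_ad_act1 C n X) (e, u).
rewrite [(ad_act _ _).1]/= [(ad_act _ _).2]/=.
rewrite (ext_in_ract e h) lie_in_Ad.
have -> : stab_in (h^-1)%g = (stab_in h)^-1%g by [].
exact: ad_cl_ract.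
Qed.

Lemma Ad_nrm (z : Ext) (Q : M) :
  Ad ((gg z : G)^-1)%g (pgl Q) = pgl (invmx (nrm z) *m Q *m nrm z).
Proof.
have E : ((gg z : G)^-1)%g = pcl (invmx (nrm z)).
  by rewrite -(pclV (nrm_unit z)) pcl_nrm.
rewrite E PGL_AdE ?unitmx_inv ?nrm_unit // invmxK.
by rewrite (pgl_conj_lam _ (nrm_unit z)).
Qed.

(** Moving from the frame [z] = (x, g) to the frame (x, 1) of E_H undoes Ad(g^-1), so the coordinate
    becomes the commutator itself, which lies in h. *)
Lemma curv_in_range (z : Ext) u v : range (iota1 i (E := tb)) (curv conn z u v).
Proof.
rewrite curvE; set Q := _ - _; have pQ : parab Q := w_parab _ _.
(* The coordinates of h describe matrices with (0, 0) entry 0; subtracting a scalar achieves this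
   and is invisible in pgl. *)
pose xi := hprj (Q - (Q 0 0)%:M : M).
exists (ad_cl ((eproj z, 1%g) : tb) xi) => //.
rewrite ad_cl_in stab_lie_inE /xi nlam_hprj; last 2 first.
- by apply: parabB => //; rewrite -scalemx1; apply: parabZ; exact: parab1.
- by rewrite !mxE eqxx subrr.
rewrite -raddfN pglDscalar -Ad_nrm -[LHS](ad_cl_ract _ (gg z : G)).
exact: (congr1 (fun z' : Ext => ad_cl z' _) (esym (ext_from_in z))).
Qed.

(** Vanishing in pgl means being scalar, a property that conjugation by [nrm z] preserves. *)
Lemma curv_neq0 (z : Ext) u v :
  (forall c, w (lsubmx u) *m w (lsubmx v) - w (lsubmx v) *m w (lsubmx u) <> c%:M) ->
  curv conn z u v <> ad_cl z 0.
Proof.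
rewrite curvE; set Q := _ - _ => Qc /ad_cl_inj; rewrite -(pgl_scalar n 0) => /pglP [c].
rewrite raddf0 add0r => E; apply: (Qc c).
have uN := nrm_unit z; have := congr1 (fun B => nrm z *m B *m invmx (nrm z)) E.
by rewrite /= !mulmxA mulmxV // mul1mx mulmxK // mul_mx_scalar -scalemxAl mulmxV // scalemx1.
Qed.

End Curvature.

(** * Holomorphy of theta and its bijectivity on fibres *)

Section Soldering.
Variables (C : numFieldType) (n : nat) (X : manifold C n).
Hypothesis flX : flat_atlas X.
Local Notation M := 'M[C]_n.+1.
Local Notation G := (PGL_lie C n).
Local Notation H := (stab_lie C n).
Local Notation i := (@stab_in C n).
Local Notation k := (n.+1 * n.+1).-1.
Local Notation m := (n + n * n)%N.
Local Notation tb := (trivial_bundle X).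
Local Notation Ext := (@ext C n m k X H G i tb).
Local Notation eproj := (@ext_proj C n m k X H G i tb).
Local Notation ein := (@ext_in C n m k X H G i tb).
Local Notation gg := (@ext_gpart C n X).

Variable w : 'rV[C]_n -> M.
Hypothesis w_linear : linear w.
Local Notation lifted_form := (lifted_form w).
Local Notation tb_form := (@tb_form C n X w).
Local Notation theta := (@theta C n X w).

Let dX : forall x : X, cdom (chart_at x) x := flX.1.1.

Lemma weak_atlas_vecm p : weak_atlas (vecm C p).
Proof. by []. Qed.

Lemma wr_pair p r l (N : manifold C p) (P : manifold C r) (f : N -> P)
  (g : N -> 'rV[C]_l) x y : wr (N := prodm P (vecm C l)) (fun x => (f x, g x)) x y =
  row_mx (wr f x y) (g (cinv (chart_at x) y)).
Proof. by []. Qed.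

Lemma wr_ext p (N : manifold C p) (f : N -> Ext) x y : wr f x y =
  row_mx (cmap (chart_at (eproj (f x))) (eproj (f (cinv (chart_at x) y))))
    (kap (pidx (gg (f x))) (rmx (gg (f (cinv (chart_at x) y))))).
Proof. by []. Qed.

Lemma cdom_subst (p p' q q' : X) : p = p' -> q = q' ->
  cdom (chart_at p') q' -> cdom (chart_at p) q.
Proof. by move=> -> ->. Qed.

Lemma rmx_subst (g g' h h' : PGL C n) : g = g' -> h = h' ->
  rmx h' (pidx g').1 (pidx g').2 != 0 -> rmx h (pidx g).1 (pidx g).2 != 0.
Proof. by move=> -> ->. Qed.

Lemma tangent_near (q : tangentm tb) (s := pidx (val q.1.2)) :
  \forall y \near cmap (chart_at q) q,
  [/\ cdom (chart_at q.1.1) (cinv (chart_at q.1.1) (lsubmx (lsubmx y))),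
      cmap (chart_at q.1.1) (cinv (chart_at q.1.1) (lsubmx (lsubmx y))) =
        lsubmx (lsubmx y),
      nu (rsubmx (lsubmx y)) \in unitmx,
      nu (rsubmx (lsubmx y)) s.1 s.2 != 0 &
      forall v, of_chart (chart_at q.1) (lsubmx y) v = v].
Proof.
case: q @s => e v s.
have de : cdom (chart_at e) e := (flat_tb flX).1.1 e.
have n1 := tb_near flX (dX e.1).
have n2 := flat_of_chart_near (flat_tb flX) de.
have n3 : \forall y \near cmap (chart_at e) e, nu (rsubmx y) s.1 s.2 != 0.
  have d := is_diff_comp_coord s.1 s.2
    (is_diff_then (nu_is_diff (rsubmx (cmap (chart_at e) e))) (is_diff_rsub _)).
  have P0 : nu (rsubmx (cmap (chart_at e) e)) s.1 s.2 != 0.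
    rewrite tb_cmapE row_mxKr nu_hmx; apply: pidx_neq0; first exact: hmx_unit.
    exact: pcl_hmx.
  have [c _] := d; have : {for cmap (chart_at e) e,
    continuous (fun y => nu (rsubmx y) s.1 s.2 : C)}.
    exact: differentiable_continuous c.
  by move=> /cvgr_neq0 /(_ P0).
have n4 : \forall y \near to_chart (chart_at e) e v, True by exact: filterE.
have n5 := near_row_mx (near_and n1 (near_and n2 n3)) n4.
apply: filterS n5 => y [[[h1 h2 h3] [h4 h5]] _].
by split.
Qed.

Lemma theta_holo : holo_quot theta.
Proof.
(* Before passing to quotients, theta has a global lift, given by [ein] on frames and [tb_form] on
   vectors. *)
move=> q0; exists setT, (fun q : tangentm tb => (ein q.1, tb_form q.1 q.2) : prodm Ext (vecm C k)).
split; [exact: I| |by case=> e v _; exact: thetaE].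
apply: holoI.
- exact/flat_atlas_tangent/flat_tb.
- by apply: weak_atlas_prod; [exact: weak_atlas_ext|exact: weak_atlas_vecm].
- move=> q; apply: filterS (tangent_near q) => y [d1 E1 u1 s1 oc].
  split; [split; [exact: I| |]|exact: I].
    exact: (cdom_subst (eproj_in q.1) (eproj_in (cinv (chart_at q) y).1) d1).
  apply: (rmx_subst (gg_in q.1) (gg_in (cinv (chart_at q) y).1)).
  have -> : val (cinv (chart_at q) y).1.2 = pcl (nu (rsubmx (lsubmx y))).
    by apply: val_scl u1 _; exact: nu_parab.
  have [c c0 E] := rmx_pcl u1; move: s1; rewrite {1}E mxE mulf_eq0 negb_or.
  by move=> /andP[].
move=> q; set o := cmap _ _; set s := pidx (val q.1.2).
have dnu : is_diff o (fun y => nu (rsubmx (lsubmx y))) (fun v => nlam (rsubmx (lsubmx v))) :=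
  is_diff_then (nu_is_diff _) (is_diff_then (is_diff_rsub _) (is_diff_lsub o)).
have oE : nu (rsubmx (lsubmx o)) = hmx q.1.2.
  by rewrite /o /= row_mxKl row_mxKr -/(hmx _) -/(hprj _) nu_hmx.
have P0 : nu (rsubmx (lsubmx o)) s.1 s.2 != 0.
  by rewrite oE; apply: pidx_neq0; [exact: hmx_unit|exact: pcl_hmx].
have uo : nu (rsubmx (lsubmx o)) \in unitmx by rewrite oE hmx_unit.
have d1 := @kap_is_diff _ _ _ s _ _ o P0 dnu.
have d2 := is_diff_row_mx (is_diff_then (is_diff_lsub _) (is_diff_lsub o)) d1.
have d3 := @is_diff_invmx _ _ _ (fun y => nu (rsubmx (lsubmx y))) _ o uo dnu.
have d4 : is_diff o (fun y => w (lsubmx (rsubmx y))) (fun y => w (lsubmx (rsubmx y))) :=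
  is_diff_then (is_diff_linear _ w_linear) (is_diff_then (is_diff_lsub _) (is_diff_rsub o)).
have d5 : is_diff o (fun y => nlam (rsubmx (rsubmx y))) (fun y => nlam (rsubmx (rsubmx y))) :=
  is_diff_then (is_diff_linear _ (@nlam_linear C n))
    (is_diff_then (is_diff_rsub _) (is_diff_rsub o)).
have d6 := is_diff_then (is_diff_linear _ (@pgl_linear C n))
  (is_diff_mulmx d3 (is_diff_add (is_diff_mulmx d4 dnu) d5)).
apply: differentiable_near (is_diff_row_mx d2 d6).
apply: filterS (tangent_near q) => y [_ E1 u1 _ oc].
apply: (etrans _ (esym (wr_pair (fun q : tangentm tb => ein q.1)
  (fun q => tb_form q.1 q.2) q y))).
apply: (etrans _ (esym (congr2 (@row_mx _ _ _ _) (wr_ext _ _ _) erefl))).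
have e2 : (cinv (chart_at q) y).2 = rsubmx y := oc (rsubmx y).
have e1 : (cinv (chart_at q) y).1 =
   (cinv (chart_at q.1.1) (lsubmx (lsubmx y)), scl (nu (rsubmx (lsubmx y)))) by [].
rewrite e2 e1 /tb_form /lifted_form hmx_scl_nu //; congr row_mx.
rewrite -[in LHS](kap_rmx_pcl s u1) -[in LHS]E1.
apply: row_kap_eq; apply/esym; [exact: eproj_in|exact: eproj_in|exact: gg_in|].
rewrite gg_in val_scl //; exact: nu_parab.
Qed.

(** With [w_surj]: modulo scalars, gl is the direct sum of the image of [w] and h, that is, [w]
    induces an isomorphism onto g/h. *)
Hypothesis w_inj : forall a (v : 'rV[C]_m) c, w a + nlam v = c%:M -> a = 0 /\ v = 0.
Hypothesis w_surj : forall B : M, exists a v c, w a + nlam v = B + c%:M.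

Lemma tb_form1E x v : tb_form ((x, 1%g) : tb) v = pgl (w (lsubmx v) + nlam (rsubmx v)).
Proof. by rewrite /tb_form /lifted_form hmx1 invmx1 mul1mx mulmx1. Qed.

(** Right translation by the inverse of h brings a vector to the unit section, where [tb_form] is
    just w + [nlam] modulo scalars. *)
Lemma at_cl_unit (a : At tb) : exists v, a = at_cl ((at_proj a, 1%g) : tb) v.
Proof.
case E : (rep a) => [[x h] v].
exists (mderiv (fun e : tb => ract e h^-1%g) (x, h) v).
rewrite /at_proj E /= -(repK a) E.
rewrite -[LHS](cl_act (tb_at_actM flX) _ (h^-1)%g).
by rewrite /at_act /= mulgV.
Qed.

Lemma at_proj_cl (e : tb) v : at_proj (at_cl e v) = e.1.
Proof. by rewrite /at_proj; have [h ->] := rep_cl (tb_at_act1 flX) (e, v). Qed.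

Lemma ad_proj_cl (z : Ext) u : ad_proj (ad_cl z u) = eproj z.
Proof.
rewrite /ad_proj; have [g ->] := rep_cl (@ext_ad_act1 C n X) (z, u).
exact: eproj_ract.
Qed.

Lemma theta_bij x : set_bij [set a | at_proj a = x] [set b | ad_proj b = x] theta.
Proof.
split.
- move=> a ax; have {}ax : at_proj a = x := ax; have [v E] := at_cl_unit a.
  suff : ad_proj (theta a) = x by [].
  by rewrite E ax (thetaE flX) ad_proj_cl eproj_in.
- move=> a b /set_mem ax /set_mem bx.
  have {}ax : at_proj a = x := ax; have {}bx : at_proj b = x := bx.
  have [v Ea] := at_cl_unit a; have [u Eb] := at_cl_unit b.
  rewrite ax in Ea; rewrite bx in Eb; rewrite Ea Eb.
  rewrite !(thetaE flX) => /ad_cl_inj; rewrite !tb_form1E => /pglP [c E].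
  have [] := @w_inj (lsubmx v - lsubmx u) (rsubmx v - rsubmx u) c.
    have wB a' b' : w (a' - b') = w a' - w b'.
      by have := w_linear (-1) b' a'; rewrite !scaleN1r => E'; rewrite addrC E' addrC.
    have nB a' b' : nlam (a' - b') = nlam a' - nlam b' :> M.
      by have := @nlam_linear C n (-1) b' a'; rewrite !scaleN1r => E'; rewrite addrC E' addrC.
    by rewrite wB nB addrACA E -opprD addrAC subrr add0r.
  move=> /subr0_eq El /subr0_eq Er.
  by rewrite -(hsubmxK v) El Er hsubmxK.
move=> b bx; set z := (rep b).1; have {}bx : eproj z = x := bx.
(* Passing from the frame [z] = (x, g) to (x, 1) multiplies the coordinate by Ad(g). *)
have [a [v [c E]]] := w_surj (lam (s1 C n) (Ad (gg z : G) (rep b).2)).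
exists (at_cl ((x, 1%g) : tb) (row_mx a v)); first exact: at_proj_cl.
rewrite (thetaE flX) tb_form1E row_mxKl row_mxKr E pglDscalar pgl_lam.
rewrite -[LHS](ad_cl_ract _ (gg z : G)) -PGL_AdM mulVg PGL_Ad1.
have Ez : ract (ein (x, 1%g)) (gg z : G) = z.
  by rewrite -bx; exact: esym (ext_from_in z).
rewrite Ez -[RHS]repK /ad_cl; congr cl.
by rewrite /z; case: (rep b).
Qed.

End Soldering.

(** * Second countability of the torus and of E_H *)

Section TorusCountable.
Variables (R : realType) (n : nat).
Local Notation C := (R[i] : numFieldType).

(** All charts have the same radius, so those at the classes of a countable dense set cover the
    torus. *)
Lemma torus_cover : exists s : nat -> torus R n, forall x, exists k, cdom (chart_at (s k)) x.
Proof.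
have [D HD] := complex_dense R.
exists (fun k => tpi (if unpickle k is Some q then map_mx D (q : 'rV[nat]_n) else 0)) => x.
have [q Hq] := choice (fun j => HD (rep x 0 j) _ (complex_half_gt0 R)).
exists (pickle (\row_j q j)); rewrite pickleK; set y : 'rV[C]_n := map_mx D _.
(* The chart at [tpi y] is centred at a lattice translate of [y], so the lift of [x] must be
   translated likewise. *)
have [l E] := tpiP (tpi_rep (tpi y)).
have xy : ball y (2^-1 : C) (rep x).
  split=> [|i j]; first exact: complex_half_gt0.
  by rewrite !mxE ord1 /ball /= distrC; exact: Hq.
exists (rep x - lattice_vec R l); last first.
  by rewrite -lattice_vecN tpiD tpi_rep.
move: xy; rewrite -!ball_normE /ball_ /= {1}E opprB.
by rewrite addrA [_ + lattice_vec R l - rep x]addrAC.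
Qed.

Lemma torus_second_countable : @second_countable (mpt (torus R n)).
Proof.
have [D HD] := complex_dense R; have [s Hs] := torus_cover.
exact: second_countable_flat HD (@complex_archimedean R) (@torus_flat R n) Hs.
Qed.

Lemma tb_is_manifold : is_manifold (trivial_bundle (torus R n)).
Proof.
have fl := flat_tb (@torus_flat R n).
have [D HD] := complex_dense R; have [s Hs] := torus_cover.
apply: flat_is_manifold => //.
  apply: hausdorff_prodm; [exact: torus_flat|exact: stab_flat|exact: torus_hausdorff|].
  exact: stab_hausdorff.
have cov : forall x : trivial_bundle (torus R n), exists k,
    cdom (chart_at ((s k, 1%g) : trivial_bundle (torus R n))) x.
  by move=> [x h]; have [k Hk] := Hs x; exists k.
exact: (second_countable_flat HD (@complex_archimedean R) fl cov).
Qed.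

End TorusCountable.

(** * The constant form A dz1 + B dz2 on C^2 *)

Section Example.
Variable C : numFieldType.

Let i1 : 'I_(1 + 2) := Ordinal (isT : 1 < 3)%N.
Let i2 : 'I_(1 + 2) := Ordinal (isT : 2 < 3)%N.

Definition omega (v : 'rV[C]_2) : 'M[C]_3 :=
  v 0 0 *: delta_mx i1 0 + v 0 1 *: (delta_mx i2 0 + delta_mx 0 i2).

Lemma omega_linear : linear omega.
Proof.
by move=> c u v; apply/matrixP => p q; rewrite !mxE; ring.
Qed.

Lemma omega_comm a b : omega a *m omega b - omega b *m omega a =
  (a 0 0 * b 0 1 - a 0 1 * b 0 0) *: delta_mx i1 i2.
Proof.
apply/matrixP => -[[|[|[|//]]] Hp] [[|[|[|//]]] Hq];
  rewrite !mxE !big_ord_recl !big_ord0 !mxE /=; ring.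
Qed.

(** The part of the form in g/h is the identity of C^2, which gives both complement conditions. *)
Lemma omega_col a : dlsubmx (omega a : 'M[C]_(1 + 2)) = a^T.
Proof.
apply/matrixP => -[[|[|//]] Hp] q; rewrite !mxE ord1 /=.
  by rewrite !addr0 mulr1 mulr0 addr0; congr (a _ _); apply/val_inj.
by rewrite mulr0 add0r addr0 mulr1; congr (a _ _); apply/val_inj.
Qed.

Lemma omega00 a : omega a 0 0 = 0.
Proof. by rewrite !mxE /=; ring. Qed.

Lemma omega_inj a (v : 'rV[C]_(2 + 2 * 2)) c :
  omega a + nlam v = c%:M -> a = 0 /\ v = 0.
Proof.
move=> E; have c0 : c = 0.
  have := congr1 (fun B : 'M[C]_3 => B 0 0) E.
  by rewrite mxE omega00 nlam00 addr0 mxE => ->.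
have a0 : a = 0.
  apply/trmx_inj; rewrite -omega_col trmx0; apply/matrixP => p q.
  have := congr1 (fun B : 'M[C]_(1 + 2) => dlsubmx B p q) E; rewrite c0 raddf0.
  have /matrixP/(_ p q) := nlam_parab v; rewrite !mxE => ->.
  by rewrite addr0.
split=> //; rewrite -(hprj_nlam v); move: E; rewrite a0 c0 raddf0.
have -> : omega 0 = 0 by apply/matrixP => p q; rewrite !mxE; ring.
rewrite add0r => ->; have := @hprj_linear C 2 (-1) 0 0.
by rewrite !scaleN1r !addNr.
Qed.

Lemma omega_surj (B : 'M[C]_3) : exists a (v : 'rV[C]_(2 + 2 * 2)) c,
  omega a + nlam v = B + c%:M.
Proof.
pose a : 'rV[C]_2 := (dlsubmx (B : 'M[C]_(1 + 2)))^T.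
(* The first column of [B] below the diagonal dictates [a], the scalar clears the (0, 0) entry, and
   what remains lies in h. *)
exists a, (hprj (B - (B 0 0)%:M - omega a)), (- B 0 0).
rewrite nlam_hprj ?raddfN; last 2 first.
- apply/matrixP => p q; have /matrixP/(_ p q) := omega_col a.
  rewrite /a trmxK !mxE => ->.
  by case: eqP => [/(congr1 val)|_]; rewrite ?ord1 // subr0 subrr.
- rewrite mxE [X in _ + X]mxE omega00 subr0 mxE [X in _ + X]mxE.
  by rewrite [X in - X]mxE eqxx subrr.
by rewrite addrC subrK.
Qed.

End Example.

Theorem proposition3p4 (R : realType) :
  exists X : manifold R[i] 2,
    [/\ is_manifold X, compact [set: mpt X], connected [set: mpt X] &
      exists B : branched_cartan X (@stab_in R[i] 2),
        normal_cartan B /\ ~ flat_cartan B].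
Proof.
pose C : numFieldType := R[i].
exists (torus R 2); have fl := @torus_flat R 2.
split.
- apply: flat_is_manifold => //; first exact: torus_hausdorff.
  exact: torus_second_countable.
- exact: torus_compact.
- exact: torus_connected.
have wl := @omega_linear C.
have iso : exists U : set (torus R 2), [/\ open (U : set (mpt (torus R 2))), U !=set0 &
    forall x, U x -> set_bij [set a | at_proj a = x] [set b | ad_proj b = x]
      (@theta C 2 (torus R 2) (@omega C))].
  (* The open set is all of X: this geometry has no branch points. *)
  exists setT; split; [exact: openT|by exists (tpi 0)|move=> x _].
  apply: theta_bij => //; [exact: omega_inj|exact: omega_surj].
exists (BranchedCartan (is_pbundle_tb fl (@tb_is_manifold R 2)) (theta_linear fl wl)
  (theta_holo fl wl) iso (theta_iota fl wl) (conn_def fl wl)).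
split=> [z u v|F].
  apply: curv_in_range => // a b; rewrite omega_comm.
  apply/matrixP => -[[|[|//]] Hp] q; rewrite !mxE ord1 /=; exact: mulr0.
pose z : ext (@stab_in C 2) (trivial_bundle (torus R 2)) :=
  ext_in _ ((tpi 0, 1%g) : trivial_bundle (torus R 2)).
(* On the two coordinate directions the commutator is E12, whose (1, 2) entry is 1, whereas a scalar
   matrix has 0 there. *)
have := F z (row_mx (delta_mx 0 0) 0) (row_mx (delta_mx 0 1) 0).
apply: curv_neq0 => // c; rewrite !row_mxKl omega_comm => /matrixP.
move=> /(_ (Ordinal (isT : 1 < 3)%N) (Ordinal (isT : 2 < 3)%N)) /eqP; rewrite !mxE /=.
by rewrite !mulr1 mulr0 subr0 oner_eq0.
Qed.
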